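(* Let $E$ and $F$ be Banach spaces. Suppose $E$ does not have the Schur property, $F$ contains a copy of $\ell_1$, and $\mathcal{L}(E,F^* )=\mathcal{L}_{\mathrm{cc}}(E,F^* )$ (that is, every bounded linear operator from $E$ into $F^*$ is completely continuous). Then $E\widehat{\otimes}_\pi F$ does not have the Dunford-Pettis property.
   Context: $E\widehat{\otimes}_\pi F$ is the (completed) projective tensor product of $E$ and $F$. $E^*$ denotes the dual of $E$. An operator is a bounded linear map; $\mathcal{L}(E,F)$ is the space of all operators from $E$ into $F$. An operator is completely continuous if it takes weak Cauchy sequences into norm Cauchy sequences; $\mathcal{L}_{\mathrm{cc}}(E,F)$ is the space of completely continuous operators from $E$ into $F$. A Banach space $E$ has the Dunford-Pettis property if every weakly compact operator from $E$ into any Banach space is completely continuous; equivalently, $\lim_n\phi_n(x_n)=0$ for all weakly null sequences $(x_n)\subset E$ and $(\phi_n)\subset E^*$. A Banach space has the Schur property if every weakly convergent sequence in it converges in norm. ''$F$ contains a copy of $\ell_1$'' means $F$ has a closed subspace isomorphic (linearly homeomorphic) to $\ell_1$. *)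

(* Defs.v *)
From HB Require Import structures.
From mathcomp Require Import all_boot all_order all_algebra sesquilinear complex.
From mathcomp Require Import all_classical all_reals all_analysis.
Set Implicit Arguments.
Unset Strict Implicit.
Unset Printing Implicit Defensive.
Import Order.TTheory GRing.Theory Num.Theory.
Import numFieldNormedType.Exports.
Local Open Scope classical_set_scope.
Local Open Scope ring_scope.

(* Banach spaces are taken over the real or the complex field. *)
Inductive scalar_kind := Reals | Complexes.

Definition scalars (R : realType) (k : scalar_kind) : numFieldType :=
  match k with Reals => R | Complexes => R[i] end.

Section scalars.
Context {R : realType} {k : scalar_kind}.
Local Notation K := (scalars R k).

(* The norm of a [normedModType K] is [K]-valued, whereas suprema and series
   live in [R]: [ofR] embeds [R] in [K] and [modulus] is the [R]-valued
   absolute value of [K], so that [ofR (modulus z) = `|z|] (lemma [ofR_modulus]). *)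
Definition ofR : R -> K :=
  match k return R -> scalars R k with
  | Reals => fun r => r
  | Complexes => fun r => r%:C%C
  end.

Definition modulus : K -> R :=
  match k return scalars R k -> R with
  | Reals => fun z => `|z|
  | Complexes => fun z => Normc.normc z
  end.

Lemma ofR_modulus (z : K) : ofR (modulus z) = `|z|.
Proof. by rewrite /ofR /modulus; case: k z. Qed.

Lemma ofRD (r s : R) : ofR (r + s) = ofR r + ofR s.
Proof. by rewrite /ofR; case: k => //; rewrite rmorphD. Qed.

Lemma ofRM (r s : R) : ofR (r * s) = ofR r * ofR s.
Proof. by rewrite /ofR; case: k => //; rewrite rmorphM. Qed.

Lemma ofR_inj : injective ofR.
Proof. by rewrite /ofR; case: k => // r s /= []. Qed.

Lemma ofR0 : ofR 0 = 0. Proof. by rewrite /ofR; case: k. Qed.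

Lemma ler_ofR (r s : R) : (ofR r <= ofR s) = (r <= s).
Proof. by rewrite /ofR; case: k => //; rewrite lecR. Qed.

Lemma modulus_ge0 (z : K) : 0 <= modulus z.
Proof. by rewrite -ler_ofR ofR0 ofR_modulus. Qed.

Lemma modulus_eq0 (z : K) : modulus z = 0 -> z = 0.
Proof. by move=> /(congr1 ofR); rewrite ofR_modulus ofR0 => /normr0_eq0. Qed.

Lemma modulus0 : modulus 0 = 0.
Proof. by apply: ofR_inj; rewrite ofR_modulus ofR0 normr0. Qed.

Lemma modulusD (x y : K) : modulus (x + y) <= modulus x + modulus y.
Proof. by rewrite -ler_ofR ofRD !ofR_modulus ler_normD. Qed.

Lemma modulusM (x y : K) : modulus (x * y) = modulus x * modulus y.
Proof. by apply: ofR_inj; rewrite ofRM !ofR_modulus normrM. Qed.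
End scalars.

Section operators.
Context {K : numFieldType}.

Definition operators (E G : normedModType K) : set (E -> G) :=
  [set T | linear T /\ exists M : K, forall x, `|T x| <= M * `|x| ].
End operators.
Arguments operators {K} E G.

Section dual.
Context {R : realType} {k : scalar_kind}.
Local Notation K := (scalars R k).
Variable E : normedModType K.

Definition is_functional : {pred E -> K^o} :=
  fun f => `[< operators E K^o f >].

Record dual_space :=
  DualSpace {dual_fun :> E -> K^o; _ : dual_fun \in is_functional}.

HB.instance Definition _ := [isSub for dual_fun].
HB.instance Definition _ := [Choice of dual_space by <:].

Lemma is_functional_submod : submod_closed is_functional.
Proof.
split=> [|a f g /asboolP[flin [M fM]] /asboolP[glin [N gN]]]; apply/asboolP.
- split; first by move=> a x y; rewrite [RHS]addr0 [RHS]scaler0.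
  by exists 0 => x; rewrite normr0 mul0r.
- have afgE x : (a *: f + g) x = a *: f x + g x by [].
  split.
    move=> b x y; rewrite !afgE flin glin !scalerDr !scalerA.
    by rewrite (mulrC a b) addrACA.
  exists (`|a| * M + N) => x; rewrite afgE mulrDl.
  rewrite (le_trans (ler_normD _ _))// lerD//.
  by rewrite normrM -mulrA ler_wpM2l.
Qed.

HB.instance Definition _ :=
  GRing.isSubmodClosed.Build K (E -> K^o) is_functional is_functional_submod.
HB.instance Definition _ := [SubChoice_isSubLmodule of dual_space by <:].


Definition dual_norm (f : dual_space) : K :=
  ofR (sup [set modulus (f x) | x in [set x : E | `|x| <= 1]]).

Let ball_image (f : dual_space) :=
  [set modulus (f x) | x in [set x : E | `|x| <= 1]].

Let has_sup_ball (f : dual_space) : has_sup (ball_image f).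
Proof.
split; first by exists (modulus (f 0)), 0 => //=; rewrite normr0 ler01.
case: f => f /= fP; have /asboolP[_ [M fM]] := fP.
exists (modulus M) => _ [x /= x1 <-]; rewrite -(@ler_ofR _ k) !ofR_modulus.
rewrite (le_trans (fM x))// (@le_trans _ _ (`|M * `|x| |))//.
  by rewrite real_ler_norm// (ger0_real (le_trans (normr_ge0 _) (fM x))).
by rewrite normrM normr_id ler_piMr.
Qed.

Let le_sup_ball (f : dual_space) x :
  `|x| <= 1 -> modulus (f x) <= sup (ball_image f).
Proof. by move=> x1; apply: ub_le_sup; [case: (has_sup_ball f)|exists x]. Qed.

Let sup_ball_ge0 (f : dual_space) : 0 <= sup (ball_image f).
Proof.
apply: le_trans (@le_sup_ball f 0 _); first exact: modulus_ge0.
by rewrite normr0 ler01.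
Qed.

Let dual_lin (f : dual_space) : linear f.
Proof. by case: f => f fP; have /asboolP[] := fP. Qed.

Let dual_scale (f : dual_space) a x : f (a *: x) = a * f x.
Proof.
have f0 : f 0 = 0.
  have := dual_lin f 1 0 0; rewrite !scale1r addr0 => f00.
  by apply: (addrI (f 0)); rewrite addr0 -f00.
by have := dual_lin f a x 0; rewrite !addr0 f0 addr0.
Qed.

Lemma dual_normP (f : dual_space) x : `|f x| <= dual_norm f * `|x|.
Proof.
have [->|x0] := eqVneq x 0.
  by rewrite -[0](scale0r (0 : E)) dual_scale mul0r scale0r !normr0 mulr0.
have nx0 : `|x| != 0 by rewrite normr_eq0.
rewrite -ler_pdivrMr ?normr_gt0// -[X in _ / X]normr_id -normf_div mulrC.
rewrite -dual_scale /dual_norm -ofR_modulus ler_ofR.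
by apply: le_sup_ball; rewrite normrZ normfV normr_id mulVf.
Qed.

Let dual_normD (f g : dual_space) : dual_norm (f + g) <= dual_norm f + dual_norm g.
Proof.
rewrite -ofRD ler_ofR; apply: ge_sup; first by case: (has_sup_ball (f + g)).
move=> _ [x /= x1 <-]; rewrite (le_trans (modulusD _ _))// lerD//.
  exact: (le_sup_ball f).
exact: (le_sup_ball g).
Qed.

Let dual_normZ a (f : dual_space) : dual_norm (a *: f) = `|a| * dual_norm f.
Proof.
have le_normZ b g : dual_norm (b *: g) <= `|b| * dual_norm g.
  rewrite -ofR_modulus -ofRM ler_ofR; apply: ge_sup.
    by case: (has_sup_ball (b *: g)).
  move=> _ [x /= x1 <-]; rewrite modulusM ler_wpM2l ?modulus_ge0//.
  exact: (le_sup_ball g).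
apply/le_anti; rewrite le_normZ/=; have [->|a0] := eqVneq a 0.
  by rewrite normr0 mul0r -(@ofR0 _ k) ler_ofR; exact: sup_ball_ge0.
have na0 : 0 < `|a| by rewrite normr_gt0.
rewrite -(ler_pM2l (x := `|a|^-1)) ?invr_gt0// mulKf ?gt_eqF// -normfV.
have := le_normZ a^-1 (a *: f).
by rewrite scalerA mulVf// scale1r.
Qed.

Let dual_norm0_eq0 (f : dual_space) : dual_norm f = 0 -> f = 0.
Proof.
move=> f0; apply: val_inj; apply/funext => x /=.
by apply/eqP; rewrite -normr_le0; have := dual_normP f x; rewrite f0 mul0r.
Qed.

HB.instance Definition _ :=
  Lmodule_isNormed.Build K dual_space dual_normD dual_normZ dual_norm0_eq0.
End dual.

Section ell1.
Variables (R : realType) (k : scalar_kind).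
Local Notation K := (scalars R k).

Definition series_modulus (a : nat -> K^o) : \bar R :=
  (\sum_(0 <= n <oo) (modulus (a n))%:E)%E.

Definition summable_seq : {pred nat -> K^o} :=
  fun a => (series_modulus a < +oo)%E.

Record ell1 := Ell1 {ell1_seq :> nat -> K^o; _ : ell1_seq \in summable_seq}.

HB.instance Definition _ := [isSub for ell1_seq].
HB.instance Definition _ := [Choice of ell1 by <:].

Let series_modulus_ge0 a : (0 <= series_modulus a)%E.
Proof. by apply: nneseries_ge0 => n _ _; rewrite lee_fin modulus_ge0. Qed.

Let series_modulusZ b (a : nat -> K^o) :
  series_modulus (b *: a) = ((modulus b)%:E * series_modulus a)%E.
Proof.
rewrite /series_modulus -nneseriesZl; last first.
  by move=> *; rewrite lee_fin modulus_ge0.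
by apply: eq_eseriesr => n _; rewrite -EFinM -modulusM.
Qed.

Let le_series_modulusD (a b : nat -> K^o) :
  (series_modulus (a + b)%R <= series_modulus a + series_modulus b)%E.
Proof.
rewrite /series_modulus -nneseriesD.
- apply: lee_nneseries => n *; first by rewrite lee_fin modulus_ge0.
  by rewrite -EFinD lee_fin; exact: modulusD.
all: by move=> *; rewrite lee_fin modulus_ge0.
Qed.

Lemma summable_submod : submod_closed summable_seq.
Proof.
split=> [|b a c asum csum].
  rewrite unfold_in /series_modulus eseries0 ?ltry// => n _ _.
  by rewrite (_ : (0 : nat -> K^o) n = 0)// modulus0.
rewrite unfold_in (le_lt_trans (le_series_modulusD _ _))//.
rewrite series_modulusZ lte_add_pinfty//.
by rewrite lte_mul_pinfty// lee_fin modulus_ge0.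
Qed.

HB.instance Definition _ :=
  GRing.isSubmodClosed.Build K (nat -> K^o) summable_seq summable_submod.
HB.instance Definition _ := [SubChoice_isSubLmodule of ell1 by <:].

Definition ell1_norm (a : ell1) : K := ofR (fine (series_modulus a)).

Let ell1_fin (a : ell1) : series_modulus a \is a fin_num.
Proof. by rewrite ge0_fin_numE//; case: a. Qed.

Let ell1_normD (a b : ell1) : ell1_norm (a + b) <= ell1_norm a + ell1_norm b.
Proof.
rewrite -ofRD (@ler_ofR _ k) -fineD// fine_le ?fin_numD ?ell1_fin//.
exact: (le_series_modulusD a b).
Qed.

Let ell1_normZ b (a : ell1) : ell1_norm (b *: a) = `|b| * ell1_norm a.
Proof.
by rewrite -ofR_modulus -ofRM /ell1_norm series_modulusZ fineM.
Qed.

Let ell1_norm0_eq0 (a : ell1) : ell1_norm a = 0 -> a = 0.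
Proof.
rewrite -(@ofR0 _ k) => /ofR_inj a0; apply: val_inj; apply/funext => n /=.
apply: modulus_eq0; apply/eqP; rewrite eq_le modulus_ge0 andbT.
rewrite -lee_fin -[X in (_ <= X%:E)%E]a0 fineK//.
rewrite [leRHS](@nneseriesD1 _ _ n)//; last first.
  by move=> *; rewrite lee_fin modulus_ge0.
by rewrite leeDl// nneseries_ge0// => m _ _; rewrite lee_fin modulus_ge0.
Qed.

HB.instance Definition _ :=
  Lmodule_isNormed.Build K ell1 ell1_normD ell1_normZ ell1_norm0_eq0.
End ell1.

Section weak_topology.
Context {R : realType} {k : scalar_kind}.
Local Notation K := (scalars R k).
Variable E : normedModType K.

Definition weakly_cvg (u : nat -> E) (l : E) : Prop :=
  forall f : dual_space E, (fun n => f (u n)) @ \oo --> f l.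

Definition weakly_cauchy (u : nat -> E) : Prop :=
  forall f : dual_space E, cauchy ((fun n => f (u n)) @ \oo).

(* The weak topology is the initial topology for the embedding of [E] in the
   product of copies of the scalar field indexed by the dual of [E]. *)
Definition weak_eval (x : E) : {ptws dual_space E -> K^o} := fun f => f x.

Definition weak_space := initial_topology weak_eval.

HB.instance Definition _ := Uniform.on weak_space.

Definition schur_property : Prop :=
  forall (u : nat -> E) (l : E), weakly_cvg u l -> cvgn u.

(* [J] is an isomorphism of [ell1] onto the closed subspace [range J] of [E]:
   the last condition is the boundedness of the inverse of [J] on its range. *)
Definition contains_copy_of_ell1 : Prop :=
  exists J : ell1 R k -> E,
    [/\ operators (ell1 R k) E J,
        closed (range J) &
        exists M : K, forall a, `|a| <= M * `|J a|].
End weak_topology.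

Section operator_classes.
Context {R : realType} {k : scalar_kind}.
Local Notation K := (scalars R k).

Definition cc_operators (E G : normedModType K) : set (E -> G) :=
  [set T | operators E G T /\
    forall u : nat -> E, weakly_cauchy u -> cauchy ((T \o u) @ \oo)].

Definition weakly_compact_operators (E G : normedModType K) : set (E -> G) :=
  [set T | operators E G T /\
    precompact (T @` [set x : E | `|x| <= 1] : set (weak_space G))].

Definition dunford_pettis_property (E : completeNormedModType K) : Prop :=
  forall G : completeNormedModType K,
    @weakly_compact_operators E G `<=` @cc_operators E G.
End operator_classes.
Arguments cc_operators {R k} E G.
Arguments weakly_compact_operators {R k} E G.

Section projective_tensor_product.
Context {K : numFieldType}.

Definition is_tensor_product (E F V : lmodType K)
    (t : {bilinear E -> F -> V}) : Prop :=
  forall (W : lmodType K) (B : {bilinear E -> F -> W}),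
    exists2 L : {linear V -> W}, (forall x y, L (t x y) = B x y) &
      forall L' : {linear V -> W}, (forall x y, L' (t x y) = B x y) -> L' =1 L.

(* The projective norm of [v] is the infimum of this set. *)
Definition representation_costs (E F : normedModType K) (V : lmodType K)
    (t : {bilinear E -> F -> V}) (v : V) : set K :=
  [set c | exists2 s : seq (E * F),
    v = \sum_(p <- s) t p.1 p.2 & c = \sum_(p <- s) `|p.1| * `|p.2|].

(* [P] is a completion of the algebraic tensor product [V] of [E] and [F]
   normed by the projective norm; such a [P] is unique up to isometry. *)
Definition is_projective_tensor_product
    (E F P : completeNormedModType K) : Prop :=
  exists (V : lmodType K) (t : {bilinear E -> F -> V}) (i : {linear V -> P}),
    [/\ is_tensor_product t,
        forall v, infimums (representation_costs t v) `|i v| &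
        dense (range i)].
End projective_tensor_product.

(* Main.v *)
Require Import Defs.
From HB Require Import structures.
From mathcomp Require Import all_boot all_order all_algebra sesquilinear complex.
From mathcomp Require Import all_classical all_reals all_analysis.
From mathcomp Require Import ring lra.
Set Implicit Arguments.
Unset Strict Implicit.
Unset Printing Implicit Defensive.
Import Order.TTheory GRing.Theory Num.Theory.
Import numFieldNormedType.Exports.
Local Open Scope classical_set_scope.
Local Open Scope ring_scope.

(** Let [x n] be a weakly null sequence of [E] that does not tend to [0] in norm
(it exists since [E] is not Schur), and let [y n] be the image in [F] of the
unit vector basis of [ell1].  The proof is a weakly compact operator [T] on the
projective tensor product and a weakly Cauchy sequence on which [T] is not
norm Cauchy; the sequence is [x n] tensor [y n].

The sequence is weakly null ([tensor_weakly_null]): a functional [phi] on the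
tensor product is an operator [S : E -> F^*], which is completely continuous by
hypothesis, so [S (x n)] tends to [0] in norm while [y n] stays bounded.

The operator [T] sends [x] tensor [y] to the sequence [g n x * f n y], where
[g n] is a norming functional of [x n] and the [f n] are functionals on [F],
biorthogonal to the [y n], with [y |-> (f n y)_n] bounded from [F] to [ell2].
As the [g n] are in the unit ball, [T] also takes its values in [ell2], and
[T (x n tensor y n)] is [`|x n|] times the [n]-th unit vector.  The distance of
two such vectors is at least [`|x n|], so this sequence is not norm Cauchy.

The [f n] exist because the inclusion of [ell1] in [ell2] is absolutely summing
and therefore extends to any superspace of [ell1]; here the extension is
obtained by a single application of the Hahn-Banach theorem on the space of
finitely supported sequences [z] of [F], with the seminorm given by the average
of [`|\sum_i +- z i|] over all choices of signs
([ell1_copy_hilbertian_functionals]).  On sequences [h i *: v] this seminorm is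
at most the [ell2] norm of [h] times [`|v|], which is the easy half of
Khinchine's inequality; on sequences of [ell1] it dominates, up to a constant,
the sum of the diagonal entries.

The codomain of [T] is taken to be [ell_infty], seen as the dual of the space
of finitely supported scalar sequences with the [ell1] norm.  It is a Banach
space, and in it the image of a ball of [ell2] is weakly compact: that image is
compact for the pointwise topology by Tychonoff's theorem, and on it every
functional of [ell_infty] is pointwise continuous
([seq_dual_hilbert_ball_precompact]). *)

(** * The Hahn-Banach theorem over the reals *)

Section hahn_banach_real.
Variables (R : realType) (V W : lmodType R) (i : W -> V) (phi : W -> R^o).
Variable p : V -> R.
Hypotheses (ilin : linear i) (philin : linear phi).
Hypothesis pD : forall x y, p (x + y) <= p x + p y.
Hypothesis pZ : forall t x, 0 <= t -> p (t *: x) = t * p x.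
Hypothesis phi_le : forall w, phi w <= p (i w).

(** Partial functionals are handled through their graphs.  Domination makes such
a graph single-valued: two values at the same point differ by a value at [0],
which is at most [p 0 = 0], and so is its opposite. *)
Definition dominated_graph (G : set (V * R)) :=
  (forall a v r w s, G (v, r) -> G (w, s) -> G (a *: v + w, a * r + s)) /\
  (forall v r, G (v, r) -> r <= p v).

Let G0 : set (V * R) := range (fun w => (i w, phi w)).

(** The one-dimensional extension step: every lower bound [r - p (v - v0)] for
the value at [v0] is below every upper bound [p (w + v0) - s], so that the
supremum of the lower bounds is an admissible value. *)
Lemma dominated_graph_extend G v0 : dominated_graph G -> G (0, 0) ->
  exists c, dominated_graph
    [set z | exists (v : V) (r t : R), G (v, r) /\ z = (v + t *: v0, r + t * c)].
Proof.
move=> [Glin Gle] G00.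
pose S := [set x.2 - p (x.1 - v0) | x in G].
have key v r w s : G (v, r) -> G (w, s) -> r - p (v - v0) <= p (w + v0) - s.
  move=> Gx Gy; have := Gle _ _ (Glin 1 _ _ _ _ Gx Gy); rewrite scale1r => h.
  have := pD (v - v0) (w + v0).
  have -> : v - v0 + (w + v0) = v + w by rewrite addrACA addNr addr0.
  by move: h; lra.
have Sub w s : G (w, s) -> ubound S (p (w + v0) - s).
  by move=> Gy _ [[v r] Gx <-]; exact: key.
have Ssup : has_sup S.
  by split; [exists (0 - p (0 - v0)), (0, 0)|exists (p (0 + v0) - 0); exact: (Sub 0)].
have GZ a v r : G (v, r) -> G (a *: v, a * r).
  by move=> Gx; have := Glin a _ _ _ _ Gx G00; rewrite !addr0.
exists (sup S); split.
  move=> a _ _ _ _ [v [r [t [Gx [-> ->]]]]] [w [s [t' [Gy [-> ->]]]]].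
  exists (a *: v + w), (a * r + s), (a * t + t'); split; first exact: Glin.
  congr pair; last by ring.
  by rewrite scalerDr scalerA scalerDl addrACA.
move=> _ _ [v [r [t [Gx [-> ->]]]]].
(* By homogeneity the bound at [v + t *: v0] reduces to the case [t = 1] or
   [t = -1], according to the sign of [t]. *)
have [t0|t0|->] := ltrgtP t 0; last first.
- by rewrite scale0r mul0r !addr0; exact: Gle.
- have : sup S <= p (t^-1 *: v + v0) - t^-1 * r.
    by apply: ge_sup; [case: Ssup|apply: Sub; exact: GZ].
  rewrite -(ler_pM2l t0) mulrBr -(pZ _ (ltW t0)) scalerDr scalerA mulrA.
  by rewrite divff ?gt_eqF// scale1r mul1r; lra.
- have s0 : 0 < - t by lra.
  have : (- t)^-1 * r - p ((- t)^-1 *: v - v0) <= sup S.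
    apply: ub_le_sup; first by case: Ssup.
    by exists ((- t)^-1 *: v, (- t)^-1 * r) => //; exact: GZ.
  rewrite -(ler_pM2l s0) mulrBr -(pZ _ (ltW s0)) scalerBr scalerA mulrA.
  by rewrite divff ?gt_eqF// scale1r mul1r scaleNr opprK; lra.
Qed.

(** The functional to be extended is given along a linear map [i] rather than on
a subspace.  Zorn's lemma is applied to the sets whose union with the initial
graph [G0] is dominated, so that the union of the empty chain is covered. *)
Lemma hahn_banach_real : exists psi : V -> R^o,
  [/\ linear psi, forall w, psi (i w) = phi w & forall v, psi v <= p v].
Proof.
pose P (X : set (V * R)) := dominated_graph (X `|` G0).
have G0P : dominated_graph G0.
  split=> [a _ _ _ _ [w _ [<- <-]] [w' _ [<- <-]]|_ _ [w _ [<- <-]]].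
    by exists (a *: w + w') => //; rewrite ilin philin.
  exact: phi_le.
have PU F : F `<=` P -> total_on F subset -> P (\bigcup_(X in F) X).
  move=> FP Ftot.
  have sub X : F X -> X `|` G0 `<=` \bigcup_(X in F) X `|` G0.
    by move=> FX z [Xz|]; [left; exists X|right].
  split; last first.
    by move=> v r [[X FX Xx]|/G0P.2//]; apply: (FP _ FX).2; left.
  move=> a v r w s [[X FX Xx]|Gx] [[Y FY Yy]|Gy].
  - have [XY|YX] := Ftot _ _ FX FY.
      by apply: (sub _ FY); apply: (FP _ FY).1; left => //; exact: XY.
    by apply: (sub _ FX); apply: (FP _ FX).1; left => //; exact: YX.
  - by apply: (sub _ FX); apply: (FP _ FX).1; [left|right].
  - by apply: (sub _ FY); apply: (FP _ FY).1; [right|left].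
  - by right; exact: G0P.1.
have [A [PA Amax]] := Zorn_bigcup PU.
pose G := A `|` G0.
have i0 : i 0 = 0.
  by have := ilin (-1) 0 0; rewrite scaler0 addr0 scaleN1r addNr.
have phi0 : phi 0 = 0.
  by have := philin (-1) 0 0; rewrite scaler0 addr0 scaleN1r addNr.
have G00 : G (0, 0) by right; exists 0 => //; rewrite i0 phi0.
have GP : dominated_graph G by [].
have Gtot v : exists r, G (v, r).
  apply: contrapT => vG; have [c cP] := dominated_graph_extend v GP G00.
  set B := (X in dominated_graph X) in cP.
  have GB : G `<=` B.
    by move=> [w r] Gx; exists w, r, 0; split => //; rewrite scale0r mul0r !addr0.
  have Bv : B (v, c).
    by exists 0, 0, 1; split => //; rewrite scale1r mul1r !add0r.
  apply: (Amax B); last first.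
    rewrite /P (_ : B `|` G0 = B)//; apply/setUidl => x G0x; apply: GB.
    by right.
  split; first by move=> x Ax; apply: GB; left.
  by move=> BA; apply: vG; exists c; left; exact: BA.
have Gfun v r s : G (v, r) -> G (v, s) -> r = s.
  move=> Gr Gs; have p0 : p 0 = 0 by rewrite -(scale0r 0) pZ ?mul0r.
  have := GP.2 _ _ (GP.1 (-1) _ _ _ _ Gr Gs).
  have := GP.2 _ _ (GP.1 (-1) _ _ _ _ Gs Gr).
  rewrite !scaleN1r addNr p0; lra.
have [psi psiP] := choice Gtot.
exists psi; split => [a x y|w|v].
- exact: (Gfun (a *: x + y)) (psiP _) (GP.1 a _ _ _ _ (psiP x) (psiP y)).
- by apply: (Gfun (i w)) (psiP _) _; right; exists w.
- exact: (GP.2 _ _ (psiP v)).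
Qed.
End hahn_banach_real.
(** * Real-valued moduli and norms *)

Section scalar_theory.
Context {R : realType} {k : scalar_kind}.
Local Notation K := (scalars R k).
Implicit Types (z w : K) (r s : R).

Lemma ofR1 : ofR 1 = 1 :> K. Proof. by rewrite /ofR; case: k. Qed.

Lemma ofRN r : ofR (- r) = - ofR r :> K.
Proof. by apply: (addIr (ofR r)); rewrite -ofRD !addNr ofR0. Qed.

Lemma ofR_ge0 r : (0 <= ofR r :> K) = (0 <= r).
Proof. by rewrite -[X in X <= _](@ofR0 R k) ler_ofR. Qed.

Lemma ltr_ofR r s : (ofR r < ofR s :> K) = (r < s).
Proof. by rewrite !lt_neqAle ler_ofR (inj_eq (@ofR_inj R k)). Qed.

Lemma ofR_gt0 r : (0 < ofR r :> K) = (0 < r).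
Proof. by rewrite -[X in X < _](@ofR0 R k) ltr_ofR. Qed.

Lemma ofR_modulus_id z : 0 <= z -> ofR (modulus z) = z.
Proof. by move=> z0; rewrite ofR_modulus ger0_norm. Qed.

Lemma modulus_ofR r : modulus (ofR r : K) = `|r|.
Proof.
apply: (@ofR_inj R k); rewrite ofR_modulus.
have [r0|r0] := leP 0 r; first by rewrite !ger0_norm ?ofR_ge0.
rewrite -normrN -(normrN r) -ofRN.
by rewrite !ger0_norm ?ofR_ge0 // oppr_ge0 ltW.
Qed.

Lemma modulus1 : modulus (1 : K) = 1.
Proof. by rewrite -ofR1 modulus_ofR normr1. Qed.

Lemma modulusN z : modulus (- z) = modulus z.
Proof. by apply: (@ofR_inj R k); rewrite !ofR_modulus normrN. Qed.

Lemma modulusB z w : modulus (z - w) = modulus (w - z).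
Proof. by rewrite -modulusN opprB. Qed.

Lemma modulusV z : modulus z^-1 = (modulus z)^-1.
Proof.
have [->|z0] := eqVneq z 0; first by rewrite !(invr0, modulus0).
have m0 : modulus z != 0.
  by apply: contra_neq z0; exact: modulus_eq0.
by apply: (mulfI m0); rewrite -modulusM !divff// modulus1.
Qed.

Lemma modulus_gt0 z : z != 0 -> 0 < modulus z.
Proof.
move=> z0; rewrite lt_neqAle modulus_ge0 andbT eq_sym.
by apply: contra_neq z0; exact: modulus_eq0.
Qed.

Lemma modulus_sum (I : Type) (s : seq I) (F : I -> K) :
  modulus (\sum_(i <- s) F i) <= \sum_(i <- s) modulus (F i).
Proof.
elim/big_ind2 : _ => [|x r y s' xr ys|//]; first by rewrite modulus0.
by rewrite (le_trans (modulusD _ _))// lerD.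
Qed.

Lemma modulus_parallelogram z w :
  modulus (z + w) ^+ 2 + modulus (z - w) ^+ 2 =
  2 * (modulus z ^+ 2 + modulus w ^+ 2).
Proof.
rewrite /modulus; case: k z w => /= z w.
  by rewrite !real_normK ?num_real//; ring.
case: z w => [a b] [c d] /=.
by rewrite !sqr_sqrtr ?addr_ge0 ?sqr_ge0//; ring.
Qed.

End scalar_theory.

Section rnorm.
Context {R : realType} {k : scalar_kind}.
Local Notation K := (scalars R k).

(** The norm as an element of [R], where the order is total. *)
Definition rnorm {V : normedModType K} (x : V) : R := modulus `|x|.

Variables V : normedModType K.
Implicit Types (x y : V) (r : R).

Lemma ofR_rnorm x : ofR (rnorm x) = `|x|.
Proof. by rewrite ofR_modulus_id. Qed.

Lemma rnorm_ge0 x : 0 <= rnorm x. Proof. exact: modulus_ge0. Qed.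

Lemma rnorm0 : rnorm (0 : V) = 0. Proof. by rewrite /rnorm normr0 modulus0. Qed.

Lemma rnormD x y : rnorm (x + y) <= rnorm x + rnorm y.
Proof. by rewrite -(@ler_ofR R k) ofRD !ofR_rnorm ler_normD. Qed.

Lemma rnormZ (a : K) x : rnorm (a *: x) = modulus a * rnorm x.
Proof. by apply: (@ofR_inj R k); rewrite ofRM !ofR_rnorm normrZ ofR_modulus. Qed.

Lemma rnormN x : rnorm (- x) = rnorm x. Proof. by rewrite /rnorm normrN. Qed.

Lemma rnormB x y : rnorm (x - y) = rnorm (y - x).
Proof. by rewrite -rnormN opprB. Qed.

Lemma rnorm_le x r : (rnorm x <= r) = (`|x| <= ofR r).
Proof. by rewrite -ofR_rnorm ler_ofR. Qed.

Lemma rnorm_lt x r : (rnorm x < r) = (`|x| < ofR r).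
Proof. by rewrite -ofR_rnorm ltr_ofR. Qed.

End rnorm.

Lemma rnorm_scalar (R : realType) (k : scalar_kind) (z : (scalars R k)^o) :
  rnorm z = modulus z.
Proof. by apply: (@ofR_inj R k); rewrite ofR_rnorm ofR_modulus. Qed.

Lemma operatorsP (R : realType) (k : scalar_kind)
    (E G : normedModType (scalars R k)) (T : E -> G) :
  operators E G T <->
  linear T /\ exists2 m : R, 0 <= m & forall x, rnorm (T x) <= m * rnorm x.
Proof.
split=> [[Tlin [M TM]]|[Tlin [m m0 Tm]]]; split=> //.
  exists (modulus M); first exact: modulus_ge0.
  move=> x; rewrite -(@ler_ofR R k) ofRM !ofR_rnorm ofR_modulus.
  rewrite (le_trans (TM x))//.
  have : 0 <= M * `|x| by rewrite (le_trans _ (TM x)).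
  by move=> /ger0_norm <-; rewrite normrM normr_id.
by exists (ofR m) => x; rewrite -!ofR_rnorm -ofRM ler_ofR.
Qed.

Section linear_predicate.
Variables (K : pzRingType) (V W : lmodType K) (f : V -> W).
Hypothesis flin : linear f.

Lemma linear_fun0 : f 0 = 0.
Proof. by have := flin (-1) 0 0; rewrite scaler0 addr0 scaleN1r addNr. Qed.

Lemma linear_funD x y : f (x + y) = f x + f y.
Proof. by have := flin 1 x y; rewrite !scale1r. Qed.

Lemma linear_funZ a x : f (a *: x) = a *: f x.
Proof. by rewrite -[a *: x]addr0 flin linear_fun0 addr0. Qed.

Lemma linear_funN x : f (- x) = - f x.
Proof. by rewrite -scaleN1r linear_funZ scaleN1r. Qed.

Lemma linear_funB x y : f (x - y) = f x - f y.
Proof. by rewrite linear_funD linear_funN. Qed.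

Lemma linear_fun_sum (I : Type) (s : seq I) (F : I -> V) :
  f (\sum_(i <- s) F i) = \sum_(i <- s) f (F i).
Proof. exact: (big_morph f linear_funD linear_fun0). Qed.
End linear_predicate.

(** * The Hahn-Banach theorem over the real or complex field *)

Section restriction_of_scalars.
Variable R : realType.

Definition real_form (V : lmodType R[i]) : Type := V.

Section real_form.
Variable V : lmodType R[i].
HB.instance Definition _ := GRing.Zmodule.on (real_form V).

Let rscale (r : R) (x : real_form V) : real_form V := (r%:C%C : R[i]) *: (x : V).

Let rscaleA a b x : rscale a (rscale b x) = rscale (a * b) x.
Proof. by rewrite /rscale scalerA rmorphM. Qed.
Let rscale1 : left_id 1 rscale.
Proof. by move=> x; rewrite /rscale scale1r. Qed.
Let rscaleDr : right_distributive rscale +%R.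
Proof. by move=> a x y; rewrite /rscale scalerDr. Qed.
Let rscaleDl x : {morph rscale^~ x : a b / a + b}.
Proof. by move=> a b; rewrite /rscale rmorphD scalerDl. Qed.

HB.instance Definition _ := GRing.Zmodule_isLmodule.Build R (real_form V)
  rscaleA rscale1 rscaleDr rscaleDl.

Lemma real_formZ (r : R) (x : V) :
  r *: (x : real_form V) = (r%:C%C : R[i]) *: x.
Proof. by []. Qed.
End real_form.
End restriction_of_scalars.

(** The complex case: extend the real part of [phi] to a real-linear [psi] and
take [psi v - i psi (i v)].  Multiplying [v] by a scalar of modulus 1 that makes
this value real and nonnegative gives the bound on its modulus. *)
Lemma hahn_banach_complex (R : realType) (V W : lmodType R[i]) (i : W -> V)
    (phi : W -> R[i]^o) (p : V -> R) :
  linear i -> linear phi -> (forall x y, p (x + y) <= p x + p y) ->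
  (forall a x, p (a *: x) = Normc.normc a * p x) ->
  (forall w, Normc.normc (phi w) <= p (i w)) ->
  exists psi : V -> R[i]^o, [/\ linear psi, forall w, psi (i w) = phi w &
    forall v, Normc.normc (psi v) <= p v].
Proof.
move=> ilin philin pD pZ phip.
have Re_le (z : R[i]) : complex.Re z <= Normc.normc z.
  case: z => a b /=; rewrite (le_trans (ler_norm a))//.
  by rewrite -sqrtr_sqr ler_sqrt ?addr_ge0 ?sqr_ge0// lerDl sqr_ge0.
pose re_phi (w : real_form W) : R^o := complex.Re (phi w).
have [|||||psi [psilin psii psip]] :=
    @hahn_banach_real R (real_form V) (real_form W) i re_phi p.
- by move=> a x y; rewrite real_formZ ilin.
- move=> a x y; rewrite /re_phi real_formZ philin; move: (phi x) (phi y).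
  by case=> [b c] [d e] /=; rewrite mul0r subr0.
- exact: pD.
- by move=> t x t0; rewrite real_formZ pZ /= expr0n addr0 sqrtr_sqr ger0_norm.
- by move=> w; rewrite (le_trans (Re_le _)).
have psiD x y : psi (x + y : V) = psi x + psi y := linear_funD psilin x y.
have psiZ (r : R) (x : V) : psi ((r%:C%C : R[i]) *: x) = r * psi x.
  exact: (linear_funZ psilin r x).
pose Psi (v : V) : R[i]^o := (psi v +i* - psi ('i%C *: v))%C.
have split_scale (b c : R) (x : V) :
    (b +i* c)%C *: x = (b%:C%C : R[i]) *: x + (c%:C%C : R[i]) *: ('i%C *: x).
  rewrite scalerA -scalerDl; congr (_ *: _).
  by apply/eqP; rewrite eq_complex /=; apply/andP; split; apply/eqP; ring.
have ii (x : V) : 'i%C *: ('i%C *: x) = - x :> V.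
  by rewrite scalerA -expr2 sqr_i scaleN1r.
have psiN (x : V) : psi (- x) = - psi x := linear_funN psilin x.
have Psilin : linear Psi.
  move=> [b c] x y; rewrite /Psi scalerDr scalerA (mulrC 'i%C) -scalerA.
  rewrite (split_scale b c x) (split_scale b c ('i%C *: x)) !psiD !psiZ ii psiN.
  by apply/eqP; rewrite eq_complex /=; apply/andP; split; apply/eqP; ring.
exists Psi; split=> // [w|v].
  rewrite /Psi -(linear_funZ ilin) !psii /re_phi (linear_funZ philin).
  case: (phi w) => b c /=; congr (_ +i* _)%C; ring.
have [->|z0] := eqVneq (Psi v) 0.
  rewrite /= expr0n addr0 sqrtr0.
  have := pZ (-1) v; have := pD v (-1 *: v).
  have := pZ 0 0; rewrite scale0r /= !expr0n addr0 sqrtr0 mul0r.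
  rewrite scaleN1r subrr oppr0 expr0n addr0 sqrrN expr1n sqrtr1 mul1r.
  by move=> -> + h; rewrite h; lra.
pose u : R[i] := ((Normc.normc (Psi v))%:C / Psi v)%C.
have Psiu : Psi (u *: v) = ((Normc.normc (Psi v))%:C)%C.
  rewrite (linear_funZ Psilin).
  by have -> : u *: Psi v = u * (Psi v : R[i]) by []; rewrite divfK.
have /= := psip (u *: v : V).
(* [Psi (u *: v)] is real, hence equal to its real part [psi (u *: v)]. *)
have -> : psi (u *: v) = complex.Re (Psi (u *: v)) by [].
rewrite Psiu /= pZ.
have n0 : Normc.normc (Psi v) != 0 by apply: contra_neq z0; exact: Normc.eq0_normc.
have -> : Normc.normc u = 1.
  apply: (mulIf n0); rewrite -Normc.normcM mul1r /u divfK//.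
  by rewrite /= expr0n addr0 sqrtr_sqr ger0_norm ?sqrtr_ge0.
by rewrite mul1r.
Qed.

Lemma hahn_banach (R : realType) (k : scalar_kind) (V W : lmodType (scalars R k))
    (i : W -> V) (phi : W -> (scalars R k)^o) (p : V -> R) :
  linear i -> linear phi -> (forall x y, p (x + y) <= p x + p y) ->
  (forall a x, p (a *: x) = modulus a * p x) ->
  (forall w, modulus (phi w) <= p (i w)) ->
  exists psi : V -> (scalars R k)^o,
    [/\ linear psi, forall w, psi (i w) = phi w &
        forall v, modulus (psi v) <= p v].
Proof.
case: k V W i phi p => V W i phi p ilin philin pD pZ phip; last first.
  exact: (@hahn_banach_complex R V W i phi p).
have [|||psi [psilin psii psip]] := @hahn_banach_real R V W i phi p ilin philin.
- exact: pD.
- by move=> t x t0; rewrite pZ /modulus ger0_norm.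
- by move=> w; exact: le_trans (ler_norm _) (phip w).
exists psi; split=> // v; rewrite /modulus ler_norml psip andbT.
have := psip (- v); rewrite (linear_funN psilin).
have -> : p (- v) = p v by rewrite -scaleN1r pZ /modulus normrN1 mul1r.
by rewrite lerNl.
Qed.
(** * Averages over signs *)

Section sign_average.
Variables (R : realType) (V : zmodType).
Implicit Types (q : V -> R) (z : nat -> V) (s : V).

(** The mean of [q (s + \sum_(i < N) e i * z i)] over all signs [e]. *)
Fixpoint sign_average q z (N : nat) s : R :=
  if N is N'.+1 then
    (sign_average q z N' (s + z N') + sign_average q z N' (s - z N')) / 2
  else q s.

Lemma le_sign_average q q' z N s : (forall x, q x <= q' x) ->
  sign_average q z N s <= sign_average q' z N s.
Proof.
move=> qq'; elim: N s => [|N IH] s //=.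
have := IH (s + z N); have := IH (s - z N); lra.
Qed.

Lemma sign_average_ge0 q z N s : (forall x, 0 <= q x) ->
  0 <= sign_average q z N s.
Proof.
move=> q0; elim: N s => [|N IH] s //=.
have := IH (s + z N); have := IH (s - z N); lra.
Qed.

Lemma eq_sign_average q z z' N s : (forall i, (i < N)%N -> z i = z' i) ->
  sign_average q z N s = sign_average q z' N s.
Proof.
elim: N s => [//|N IH] s zz' /=; rewrite zz'//.
by rewrite !IH// => i iN; apply: zz'; rewrite ltnS ltnW.
Qed.

Lemma sign_averageM q z N s (c : R) :
  sign_average (fun x => c * q x) z N s = c * sign_average q z N s.
Proof. by elim: N s => [//|N IH] s /=; rewrite !IH; lra. Qed.

Lemma sign_average_sum (J : finType) (q : J -> V -> R) z N s :
  sign_average (fun x => \sum_j q j x) z N s = \sum_j sign_average (q j) z N s.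
Proof.
by elim: N s => [//|N IH] s /=; rewrite !IH -big_split/= mulr_suml.
Qed.

Lemma sign_average_stable q z N M s :
  (N <= M)%N -> (forall i, (N <= i)%N -> z i = 0) ->
  sign_average q z M s = sign_average q z N s.
Proof.
move=> + z0; elim: M s => [|M IH] s; first by rewrite leqn0 => /eqP ->.
rewrite leq_eqVlt => /predU1P[->//|]; rewrite ltnS => NM /=.
by rewrite z0// addr0 subr0 IH// mulrDl -splitr.
Qed.

Lemma sign_averageD q z z' N s s' : (forall x y, q (x + y) <= q x + q y) ->
  sign_average q (fun i => z i + z' i) N (s + s') <=
  sign_average q z N s + sign_average q z' N s'.
Proof.
move=> qD; elim: N s s' => [|N IH] s s' //=.
rewrite opprD !(addrACA s s').
have := IH (s + z N) (s' + z' N); have := IH (s - z N) (s' - z' N); lra.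
Qed.

Section seminorm.
Variable q : V -> R.
Hypotheses (qD : forall x y, q (x + y) <= q x + q y)
  (q2 : forall x, q (x *+ 2) = 2 * q x) (qN : forall x, q (- x) = q x).

(** Convexity: [s] is the midpoint of [s + z] and [s - z]. *)
Lemma sign_average_ge z N s : q s <= sign_average q z N s.
Proof.
elim: N s => [//|N IH] s /=.
have := IH (s + z N); have := IH (s - z N).
have := qD (s + z N) (s - z N).
by rewrite addrACA subrr addr0 -mulr2n q2; lra.
Qed.

(** [z j] is half the difference of the two vectors that differ in the [j]-th
sign only. *)
Lemma sign_average_ge_coord z N s j : (j < N)%N ->
  q (z j) <= sign_average q z N s.
Proof.
elim: N s => [//|N IH] s /=; rewrite ltnS leq_eqVlt => /predU1P[->|jN].
  have := sign_average_ge z N (s + z N); have := sign_average_ge z N (s - z N).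
  have := qD (s + z N) (- (s - z N)); rewrite qN.
  by rewrite opprB addrC addrA subrK -mulr2n q2; lra.
have := IH (s + z N) jN; have := IH (s - z N) jN; lra.
Qed.
End seminorm.
End sign_average.

Lemma sign_average_comp (R : realType) (U V : zmodType) (L : U -> V)
    (q : V -> R) (z : nat -> U) N s :
  (forall x y, L (x + y) = L x + L y) -> (forall x y, L (x - y) = L x - L y) ->
  sign_average (q \o L) z N s = sign_average q (L \o z) N (L s).
Proof. by move=> LD LB; elim: N s => [//|N IH] s /=; rewrite !IH LD LB. Qed.

Lemma sign_averageZ (R : realType) (k : scalar_kind) (V : lmodType (scalars R k))
    (q : V -> R) (z : nat -> V) N s a :
  (forall a x, q (a *: x) = modulus a * q x) ->
  sign_average q (fun i => a *: z i) N (a *: s) = modulus a * sign_average q z N s.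
Proof.
move=> qZ; elim: N s => [|N IH] s /=; first by rewrite qZ.
by rewrite -scalerDr -scalerBr !IH; lra.
Qed.

(** The mean is at most the quadratic mean, and signs are orthogonal; the
induction step is the parallelogram law. *)
Lemma sign_average_khinchine (R : realType) (k : scalar_kind)
    (h : nat -> scalars R k) N s :
  (sign_average modulus h N s) ^+ 2 <=
  modulus s ^+ 2 + \sum_(i < N) modulus (h i) ^+ 2.
Proof.
elim: N s => [|N IH] s /=; first by rewrite big_ord0 addr0.
rewrite big_ord_recr /=.
have := IH (s + h N); have := IH (s - h N).
have := modulus_parallelogram s (h N).
move: (sign_average _ _ _ _) (sign_average _ _ _ _) => a b.
have : ((a + b) / 2) ^+ 2 <= (a ^+ 2 + b ^+ 2) / 2.
  have : 0 <= (a - b) ^+ 2 by exact: sqr_ge0.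
  have -> : (a - b) ^+ 2 = 2 * (a ^+ 2 + b ^+ 2) - 4 * ((a + b) / 2) ^+ 2.
    by field.
  by lra.
lra.
Qed.

(** * Finitely supported sequences *)

Section finitely_supported.
Variables (K : pzRingType) (F : lmodType K).

Definition finitely_supported : {pred nat -> F} :=
  fun z => `[< exists N, forall i, (N <= i)%N -> z i = 0 >].

Record fsupp :=
  Fsupp {fsupp_fun :> nat -> F; _ : fsupp_fun \in finitely_supported}.

HB.instance Definition _ := [isSub for fsupp_fun].
HB.instance Definition _ := [Choice of fsupp by <:].

Lemma finitely_supported_submod : submod_closed finitely_supported.
Proof.
split=> [|a u v /asboolP[N uN] /asboolP[M vM]]; apply/asboolP.
  by exists 0%N.
exists (maxn N M) => i; rewrite geq_max => /andP[Ni Mi].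
by have -> : (a *: u + v) i = a *: u i + v i by []; rewrite uN// vM// scaler0 addr0.
Qed.

HB.instance Definition _ := GRing.isSubmodClosed.Build K (nat -> F)
  finitely_supported finitely_supported_submod.
HB.instance Definition _ := [SubChoice_isSubLmodule of fsupp by <:].

Lemma fsuppP (z : fsupp) : exists N, forall i, (N <= i)%N -> z i = 0.
Proof. by case: z => z /= zP; exact/asboolP. Qed.

Definition fsupp_bound (z : fsupp) : nat := projT1 (cid (fsuppP z)).

Lemma fsupp_bound0 z i : (fsupp_bound z <= i)%N -> z i = 0.
Proof. by rewrite /fsupp_bound; case: cid => /= N; exact. Qed.

Lemma fsuppD (u v : fsupp) i : (u + v) i = u i + v i. Proof. by []. Qed.
Lemma fsuppZ a (v : fsupp) i : (a *: v) i = a *: v i. Proof. by []. Qed.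

Lemma fsupp_inj (u v : fsupp) : (forall i, u i = v i) -> u = v.
Proof. by move=> uv; apply: val_inj; apply/funext. Qed.

Lemma single_proof n (y : F) :
  (fun i => if i == n then y else 0) \in finitely_supported.
Proof. by apply/asboolP; exists n.+1 => i; case: eqP => // ->; rewrite ltnn. Qed.

Definition single n (y : F) : fsupp := Fsupp (single_proof n y).

Lemma singleE n y i : single n y i = if i == n then y else 0.
Proof. by []. Qed.

Lemma single_linear n : linear (single n).
Proof.
move=> a x y; apply: fsupp_inj => i; rewrite fsuppD fsuppZ !singleE.
by case: eqP => // _; rewrite scaler0 addr0.
Qed.

(** Sums over the support may be taken up to any bound, which lets several
sequences be compared on a common range. *)
Lemma fsupp_sum_bound (G : nmodType) (g : nat -> F -> G) (z : fsupp) N :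
  (forall i, g i 0 = 0) -> (fsupp_bound z <= N)%N ->
  \sum_(i < fsupp_bound z) g i (z i) = \sum_(i < N) g i (z i).
Proof.
move=> g0 zN; rewrite (big_ord_widen _ (fun i => g i (z i)) zN) [LHS]big_mkcond.
apply: eq_bigr => i _; case: ltnP => // /fsupp_bound0 ->.
by rewrite g0.
Qed.
End finitely_supported.

Section fsupp_map.
Variables (K : pzRingType) (U V : lmodType K) (L : U -> V).
Hypothesis Llin : linear L.

Lemma fsupp_map_proof (z : fsupp U) : L \o z \in @finitely_supported K V.
Proof.
apply/asboolP; exists (fsupp_bound z) => i /fsupp_bound0 /= ->.
exact: linear_fun0.
Qed.

Definition fsupp_map z : fsupp V := Fsupp (fsupp_map_proof z).

Lemma fsupp_map_linear : linear fsupp_map.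
Proof. by move=> a x y; apply: fsupp_inj => i; exact: Llin. Qed.
End fsupp_map.
(** * Hilbertian functionals on a space containing ell1 *)

Section ell1_facts.
Variables (R : realType) (k : scalar_kind).
Local Notation K := (scalars R k).

Lemma ell1_sum_le (a : ell1 R k) N : \sum_(i < N) modulus (a i) <= rnorm a.
Proof.
have -> : rnorm a = fine (series_modulus a).
  by apply: (@ofR_inj R k); rewrite ofR_rnorm.
have age0 n : (0 <= (modulus (a n))%:E)%E by rewrite lee_fin modulus_ge0.
have afin : series_modulus a \is a fin_num.
  by rewrite ge0_fin_numE ?nneseries_ge0//; case: a {age0} => a /=.
rewrite -lee_fin fineK// -sumEFin -(big_mkord xpredT (fun i => (modulus (a i))%:E)).
by apply: nneseries_lim_ge.
Qed.

Lemma ell1_unit_proof n : (fun m => (m == n)%:R : K) \in @summable_seq R k.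
Proof.
rewrite unfold_in /series_modulus (@nneseriesD1 _ _ n)//; last first.
  by move=> *; rewrite lee_fin modulus_ge0.
rewrite eseries0; first by rewrite addr0 ltry.
by move=> i _ /= /negbTE ->; rewrite modulus0.
Qed.

Definition ell1_unit n : ell1 R k := Ell1 (ell1_unit_proof n).

Lemma ell1_unitE n m : ell1_unit n m = (m == n)%:R. Proof. by []. Qed.

Lemma rnorm_ell1_unit n : rnorm (ell1_unit n) = 1.
Proof.
have -> : rnorm (ell1_unit n) = fine (series_modulus (ell1_unit n)).
  by apply: (@ofR_inj R k); rewrite ofR_rnorm.
rewrite /series_modulus (@nneseriesD1 _ _ n)//; last first.
  by move=> *; rewrite lee_fin modulus_ge0.
rewrite eseries0; first by rewrite addr0 ell1_unitE eqxx modulus1.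
by move=> i _ /= /negbTE ->; rewrite modulus0.
Qed.
End ell1_facts.

Section sign_seminorm.
Variables (R : realType) (k : scalar_kind) (F : normedModType (scalars R k)).

Definition sign_seminorm (z : fsupp F) : R :=
  sign_average rnorm z (fsupp_bound z) 0.

Lemma sign_seminormE (z : fsupp F) N : (fsupp_bound z <= N)%N ->
  sign_seminorm z = sign_average rnorm z N 0.
Proof.
by move=> zN; rewrite (sign_average_stable _ _ zN)// => i; exact: fsupp_bound0.
Qed.

Lemma sign_seminormD z z' :
  sign_seminorm (z + z') <= sign_seminorm z + sign_seminorm z'.
Proof.
pose N := maxn (fsupp_bound (z + z')) (maxn (fsupp_bound z) (fsupp_bound z')).
rewrite !(@sign_seminormE _ N) ?leq_max ?leqnn ?orbT//.
have := @sign_averageD R F rnorm z z' N 0 0 (@rnormD _ _ F).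
by rewrite addr0.
Qed.

Lemma sign_seminormZ a z : sign_seminorm (a *: z) = modulus a * sign_seminorm z.
Proof.
pose N := maxn (fsupp_bound (a *: z)) (fsupp_bound z).
rewrite !(@sign_seminormE _ N) ?leq_max ?leqnn ?orbT//.
have := @sign_averageZ R k F rnorm z N 0 a (@rnormZ _ _ F).
by rewrite scaler0.
Qed.
End sign_seminorm.

(** On sequences of [ell1] this functional plays the part of the inclusion of
[ell1] in [ell2]: extended to sequences of [F] and restricted to those with one
nonzero entry, at [n], it gives the [n]-th coordinate. *)
Definition diagonal (R : realType) (k : scalar_kind) (b : fsupp (ell1 R k)) :
    (scalars R k)^o :=
  \sum_(i < fsupp_bound b) b i i.

Lemma ell1D (R : realType) (k : scalar_kind) (u v : ell1 R k) n :
  (u + v) n = u n + v n.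
Proof. by []. Qed.

Lemma ell1Z (R : realType) (k : scalar_kind) (a : scalars R k) (u : ell1 R k) n :
  (a *: u) n = a *: u n.
Proof. by []. Qed.

Section diagonal.
Variables (R : realType) (k : scalar_kind).
Implicit Type b : fsupp (ell1 R k).

Lemma diagonalE b N : (fsupp_bound b <= N)%N -> diagonal b = \sum_(i < N) b i i.
Proof.
move=> bN.
exact: (@fsupp_sum_bound _ _ (scalars R k)^o (fun i (a : ell1 R k) => a i)).
Qed.

Lemma diagonal_linear : linear (@diagonal R k).
Proof.
move=> a x y.
pose N := maxn (fsupp_bound (a *: x + y)) (maxn (fsupp_bound x) (fsupp_bound y)).
rewrite !(@diagonalE _ N) ?leq_max ?leqnn ?orbT//.
have E (i : nat) : (a *: x + y) i i = a * x i i + y i i.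
  by rewrite fsuppD fsuppZ ell1D ell1Z.
rewrite (eq_bigr (fun i : 'I_N => a * x i i + y i i)) => [|i _]; last exact: E.
by rewrite big_split -mulr_sumr.
Qed.

(** Each diagonal entry [b j j] is at most the mean of the moduli of the [j]-th
coordinate of [\sum_i +- b i], and the sum over [j] of these moduli is at most
the [ell1] norm. *)
Lemma diagonal_le b N : (fsupp_bound b <= N)%N ->
  modulus (diagonal b) <= sign_average rnorm b N 0.
Proof.
move=> bN; rewrite (diagonalE bN) (le_trans (modulus_sum _ _))//.
pose q (j : 'I_N) (a : ell1 R k) := modulus (a j).
apply: (@le_trans _ _ (\sum_(j < N) sign_average (q j) b N 0)).
  apply: ler_sum => j _.
  apply: (@sign_average_ge_coord _ _ (q j)) => // [x y|x|x]; rewrite /q.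
  - by rewrite ell1D modulusD.
  - have -> : (x *+ 2) j = ofR 2 * x j.
      by rewrite (_ : 2 = 1 + 1)// ofRD ofR1 mulrDl !mul1r.
    by rewrite modulusM modulus_ofR ger0_norm.
  - exact: modulusN.
rewrite -sign_average_sum; apply: le_sign_average => x; exact: ell1_sum_le.
Qed.
End diagonal.

(** The last clause says that [v |-> (f n v)_n] is bounded by [C] from [F] to
[ell2], in a dual form that is stable under linear combinations without an
appeal to Minkowski's inequality. *)
Lemma ell1_copy_hilbertian_functionals (R : realType) (k : scalar_kind)
    (F : normedModType (scalars R k)) :
  contains_copy_of_ell1 F ->
  exists (y : nat -> F) (f : nat -> F -> (scalars R k)^o) (B C : R),
    [/\ 0 <= C, forall n, rnorm (y n) <= B, forall n, linear (f n),
        forall n m, f n (y m) = (n == m)%:R &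
        forall N (h : nat -> scalars R k) v,
          modulus (\sum_(i < N) h i * f i v) ^+ 2 <=
          (C * rnorm v) ^+ 2 * \sum_(i < N) modulus (h i) ^+ 2].
Proof.
move=> [J [/operatorsP[Jlin [m m0 Jm]] _ [M JM]]].
have rJM a : rnorm a <= modulus M * rnorm (J a).
  rewrite -(@ler_ofR R k) ofRM !ofR_rnorm ofR_modulus.
  rewrite (le_trans (JM a))//.
  have : 0 <= M * `|J a| by rewrite (le_trans _ (JM a)).
  by move=> /ger0_norm <-; rewrite normrM normr_id.
pose C := modulus M.
have C0 : 0 <= C := modulus_ge0 _.
have [|||||L [Llin LJ Lp]] := @hahn_banach R k (fsupp F) (fsupp (ell1 R k))
    (fsupp_map Jlin) (@diagonal R k) (fun z => C * sign_seminorm z).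
- exact: fsupp_map_linear.
- exact: diagonal_linear.
- by move=> x y; rewrite -mulrDr ler_wpM2l// sign_seminormD.
- by move=> a x; rewrite sign_seminormZ mulrCA.
- move=> b.
  pose N := maxn (fsupp_bound b) (fsupp_bound (fsupp_map Jlin b)).
  rewrite (@sign_seminormE _ _ _ _ N) ?leq_maxr//.
  rewrite (le_trans (@diagonal_le _ _ _ N _)) ?leq_maxl//.
  rewrite -sign_averageM.
  have -> : sign_average (fun x => C * rnorm x) (fsupp_map Jlin b) N 0 =
      sign_average ((fun x => C * rnorm x) \o J) b N 0.
    rewrite (@sign_average_comp _ _ _ J) ?(linear_fun0 Jlin)//.
    - exact: linear_funD Jlin.
    - exact: linear_funB Jlin.
  exact: le_sign_average.
exists (fun n => J (ell1_unit R k n)), (fun n y => L (single n y)), m, C.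
split=> // [n|n|n n'|N h v].
- by rewrite (le_trans (Jm _))// rnorm_ell1_unit mulr1.
- by move=> a x y; rewrite single_linear Llin.
- have -> : single n (J (ell1_unit R k n')) =
      fsupp_map Jlin (single n (ell1_unit R k n')).
    apply: fsupp_inj => i; rewrite singleE /= .
    by case: eqP => // _; rewrite (linear_fun0 Jlin).
  set z := single n (ell1_unit R k n').
  rewrite LJ (@diagonalE _ _ _ (maxn (fsupp_bound z) n.+1)) ?leq_maxl//.
  rewrite (bigD1 (Ordinal (leq_maxr _ _)))//= eqxx ell1_unitE.
  rewrite big1 ?addr0// => i.
  by rewrite -val_eqE /= => /negbTE ->.
have -> : \sum_(i < N) h i * L (single i v) = L (\sum_(i < N) single i (h i *: v)).
  rewrite (linear_fun_sum Llin); apply: eq_bigr => i _.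
  by rewrite (linear_funZ (single_linear _)) (linear_funZ Llin).
set z := \sum_(i < N) _.
have zE i : z i = if (i < N)%N then h i *: v else 0.
  rewrite /z (big_morph (fun u : fsupp F => u i) (fun _ _ => erefl) erefl).
  case: ltnP => iN.
    rewrite (bigD1 (Ordinal iN))//= eqxx big1 ?addr0// => j.
    by rewrite -val_eqE eq_sym => /= /negbTE ->.
  by apply: big1 => j _ /=; case: eqP => // ij; move: iN; rewrite ij leqNgt ltn_ord.
have -> : (C * rnorm v) ^+ 2 * \sum_(i < N) modulus (h i) ^+ 2 =
    C ^+ 2 * (rnorm v ^+ 2 * \sum_(i < N) modulus (h i) ^+ 2).
  by rewrite exprMn mulrA.
have : modulus (L z) <= C * (rnorm v * sign_average modulus h N 0).
  rewrite (le_trans (Lp _))// ler_wpM2l//.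
  have -> : sign_seminorm z = sign_average rnorm z N 0.
    rewrite (@sign_seminormE _ _ _ _ (maxn (fsupp_bound z) N)) ?leq_maxl//.
    apply: sign_average_stable; first exact: leq_maxr.
    by move=> i Ni; rewrite zE ltnNge Ni.
  rewrite (@eq_sign_average _ _ _ _ ((fun c : (scalars R k)^o => c *: v) \o h)).
    rewrite -[X in sign_average _ _ _ X](scale0r v).
    rewrite -(@sign_average_comp _ _ _ (fun c : (scalars R k)^o => c *: v)).
    - rewrite -sign_averageM; apply: le_sign_average => c /=.
      by rewrite rnormZ mulrC.
    - by move=> x y; exact: scalerDl.
    - by move=> x y; exact: scalerBl.
  by move=> i iN; rewrite zE iN.
have A0 : 0 <= sign_average modulus h N 0.
  by apply: sign_average_ge0; exact: modulus_ge0.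
move=> h1.
rewrite (le_trans (lerXn2r 2 _ _ h1)) ?nnegrE ?modulus_ge0 ?mulr_ge0 ?rnorm_ge0//.
rewrite !exprMn ler_wpM2l ?exprn_ge0// ler_wpM2l ?exprn_ge0 ?rnorm_ge0//.
by rewrite (le_trans (sign_average_khinchine _ _ _))// modulus0 expr0n add0r.
Qed.
(** * Convergence, compact disks and completeness of dual spaces *)

Section real_radii.
Variables (R : realType) (k : scalar_kind) (V : normedModType (scalars R k)).

Lemma cvg_rnormP (F : set_system V) (l : V) : Filter F ->
  (F --> l) <-> (forall r : R, 0 < r -> F [set x | rnorm (l - x) < r]).
Proof.
move=> FF; split=> [/cvgrPdist_lt Fl r r0|Fl].
  have := Fl (ofR r); rewrite ofR_gt0 => /(_ r0).
  by apply: filterS => x /=; rewrite rnorm_lt.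
apply/cvgrPdist_lt => e e0; have e0' : 0 < modulus e.
  by apply: modulus_gt0; rewrite gt_eqF.
apply: filterS (Fl _ e0') => x /=.
by rewrite rnorm_lt ofR_modulus_id// ltW.
Qed.

Lemma cauchy_rnormP (F : set_system V) : ProperFilter F ->
  cauchy F <-> (forall r : R, 0 < r -> exists x, F [set y | rnorm (x - y) < r]).
Proof.
move=> FF; split=> [/cauchyP cF r r0|cF].
  have [|x Fx] := cF (ofR r); first by rewrite ofR_gt0.
  exists x; apply: filterS Fx => y.
  by rewrite -ball_normE /= rnorm_lt.
apply/cauchyP => e e0; have e0' : 0 < modulus e.
  by apply: modulus_gt0; rewrite gt_eqF.
have [x Fx] := cF _ e0'; exists x; apply: filterS Fx => y /=.
by rewrite -ball_normE /= rnorm_lt ofR_modulus_id// ltW.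
Qed.

Lemma cauchy_seqP (u : nat -> V) :
  cauchy (u @ \oo) <-> (forall r : R, 0 < r ->
    exists N, forall n m, (N <= n)%N -> (N <= m)%N -> rnorm (u n - u m) < r).
Proof.
split=> [/cauchy_rnormP cu r r0|cu]; last first.
  apply/cauchy_rnormP => r /cu[N uN]; exists (u N).
  by exists N => // n /= Nn; exact: uN.
have [|x [N _ uN]] := cu (r / 2); first by rewrite divr_gt0.
exists N => n m Nn Nm; have := uN n Nn; have := uN m Nm; rewrite /= => h1 h2.
have -> : u n - u m = (u n - x) + (x - u m) by rewrite addrA subrK.
rewrite (le_lt_trans (rnormD _ _))// (rnormB (u n)); lra.
Qed.

Lemma cvg_seqP (u : nat -> V) (l : V) :
  (u @ \oo --> l) <-> (forall r : R, 0 < r ->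
    exists N, forall n, (N <= n)%N -> rnorm (l - u n) < r).
Proof.
split=> [/cvg_rnormP ul r /ul[N _ uN]|ul].
  by exists N => n; exact: uN.
by apply/cvg_rnormP => r /ul[N uN]; exists N => // n; exact: uN.
Qed.

Lemma nbhs_rnorm (x : V) (r : R) : 0 < r -> nbhs x [set y | rnorm (x - y) < r].
Proof.
move=> r0; have : (nbhs x) --> x by [].
by move=> /cvg_rnormP; exact.
Qed.
End real_radii.

(** In the complex case the compact set is a square. *)
Lemma compact_disk (R : realType) (k : scalar_kind) (r : R) :
  exists2 A : set (scalars R k)^o, compact A & forall z, modulus z <= r -> A z.
Proof.
case: k.
  exists `[- r, r]%classic; first exact: segment_compact.
  by move=> z; rewrite /modulus /= in_itv /= ler_norml.
pose g (x : R * R) : R[i]^o := (x.1 +i* x.2)%C.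
exists (g @` (`[- r, r]%classic `*` `[- r, r]%classic)).
  apply: continuous_compact; last first.
    by apply: compact_setX; exact: segment_compact.
  apply: continuous_subspaceT => -[a b].
  apply/(@cvg_rnormP R Complexes) => e e0.
  have e20 : 0 < e / 2 by rewrite divr_gt0.
  exists ([set x | `|a - x| < e / 2], [set x | `|b - x| < e / 2]).
    by split; apply/nbhs_ballP; exists (e / 2).
  move=> [c d] /= [ac bd].
  rewrite /= expr0n addr0 sqrtr_sqr ger0_norm ?sqrtr_ge0//.
  apply: (@le_lt_trans _ _ (`|a - c| + `|b - d|)); last by move: ac bd; lra.
  have s0 : 0 <= `|a - c| + `|b - d| by rewrite addr_ge0.
  rewrite -(ger0_norm s0) -sqrtr_sqr ler_sqrt ?sqr_ge0// [leRHS]sqrrD.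
  rewrite -(real_normK (num_real (a - c))) -(real_normK (num_real (b - d))).
  by rewrite addrAC lerDl mulrn_wge0// mulr_ge0.
move=> [a b] abr; exists (a, b) => //=.
have : `|a| <= r /\ `|b| <= r; last first.
  by rewrite !ler_norml !in_itv /= => -[-> ->].
move: abr; rewrite /modulus /= => abr; split; apply: le_trans abr;
  by rewrite -sqrtr_sqr ler_sqrt ?addr_ge0 ?sqr_ge0// ?lerDl ?lerDr ?sqr_ge0.
Qed.

Lemma scalar_complete (R : realType) (k : scalar_kind)
    (F : set_system (scalars R k)^o) : ProperFilter F -> cauchy F -> cvg F.
Proof.
move=> FF cF; have [x Fx] := (cauchy_rnormP FF).1 cF 1 ltr01.
have [A cA xA] := compact_disk k (modulus x + 1).
apply: compact_cauchy_cvg cF _ cA; apply: filterS Fx => y /= xy.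
apply: xA; have -> : y = x - (x - y) by rewrite opprB addrC subrK.
rewrite (le_trans (modulusD _ _))// lerD// modulusN -rnorm_scalar.
exact: ltW.
Qed.

Section dual_theory.
Variables (R : realType) (k : scalar_kind) (E : normedModType (scalars R k)).
Implicit Types (f : dual_space E) (x : E).

Lemma dual_linear f : linear f.
Proof. by case: f => f fP; have /asboolP[] := fP. Qed.

Lemma dual_le f x : modulus (f x) <= rnorm f * rnorm x.
Proof.
rewrite -(@ler_ofR R k) ofRM !ofR_rnorm ofR_modulus; exact: dual_normP.
Qed.

Lemma dual_rnorm_le f (m : R) : 0 <= m ->
  (forall x, modulus (f x) <= m * rnorm x) -> rnorm f <= m.
Proof.
move=> m0 fm; rewrite rnorm_le -[`|f|]/(dual_norm f) ler_ofR.
apply: ge_sup; first by exists (modulus (f 0)), 0 => //=; rewrite normr0 ler01.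
move=> _ [x /= x1 <-]; rewrite (le_trans (fm x))// ler_piMr//.
by rewrite rnorm_le ofR1.
Qed.

Lemma dual_ext (f g : dual_space E) : (forall x, f x = g x) -> f = g.
Proof. by move=> fg; apply: val_inj; apply/funext. Qed.

Lemma dual_mk (g : E -> (scalars R k)^o) (m : R) :
  linear g -> (forall x, modulus (g x) <= m * rnorm x) ->
  exists f : dual_space E, forall x, f x = g x.
Proof.
move=> glin gm.
have gP : g \in @is_functional R k E.
  apply/asboolP/operatorsP; split=> //; exists `|m| => // x.
  rewrite rnorm_scalar (le_trans (gm x))// ler_wpM2r ?rnorm_ge0//.
  exact: ler_norm.
by exists (DualSpace gP).
Qed.

(** A Cauchy filter converges pointwise, the scalar field being complete; the
pointwise limit is a functional, and the limit in norm. *)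
Lemma dual_complete (F : set_system (dual_space E)) :
  ProperFilter F -> cauchy F -> cvg F.
Proof.
move=> FF /cauchy_rnormP cF.
have cFx x : cauchy ((fun f : dual_space E => f x) @ F).
  apply/cauchy_rnormP => r r0.
  have x1 : 0 < rnorm x + 1 by rewrite ltr_wpDl ?rnorm_ge0.
  have [|f Ff] := cF (r / (rnorm x + 1)); first by rewrite divr_gt0.
  exists (f x); change (F [set g : dual_space E | rnorm (f x - g x) < r]).
  apply: filterS Ff => g /= fg.
  have := dual_le (f - g) x; rewrite rnorm_scalar => /le_lt_trans; apply.
  rewrite ltr_pdivlMr// in fg.
  by apply: le_lt_trans fg; rewrite ler_wpM2l ?rnorm_ge0// lerDl.
have [l lP] : {l : E -> (scalars R k)^o &
    forall x, (fun f : dual_space E => f x) @ F --> l x}.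
  apply: (@choice E (scalars R k)^o (fun x z => (fun f => f x) @ F --> z)) => x.
  exists (lim ((fun f : dual_space E => f x) @ F)).
  exact: scalar_complete _ (cFx x).
have lim2 x y (r : R) : 0 < r -> F [set f : dual_space E |
    modulus (l x - f x) < r /\ modulus (l y - f y) < r].
  have lim1 z : 0 < r -> F [set f : dual_space E | modulus (l z - f z) < r].
    move=> r0; have /cvg_rnormP/(_ _ r0) h := lP z.
    have {}h : F [set f : dual_space E | rnorm (l z - f z) < r] by exact: h.
    by apply: filterS h => f; rewrite /= rnorm_scalar.
  by move=> r0; apply: filterI; exact: lim1.
have llin : linear l.
  move=> a x y; have h : (fun f : dual_space E => f (a *: x + y)) @ F -->
      (a *: l x + l y).
    have -> : (fun f : dual_space E => f (a *: x + y)) =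
        (fun f : dual_space E => a *: f x + f y).
      by apply/funext => f; exact: dual_linear.
    by apply: cvgD => //; apply: cvgZr.
  exact: cvg_unique (lP _) h.
have near_l f (r : R) : 0 <= r -> F [set g | rnorm (f - g) < r] ->
    forall x, modulus (f x - l x) <= r * rnorm x.
  move=> r0 Ffr x; apply/ler_addgt0Pr => e e0.
  have [g [fg [lg _]]] := filter_ex (filterI Ffr (lim2 x x e e0)).
  have -> : f x - l x = (f x - g x) + (g x - l x) by rewrite addrA subrK.
  rewrite (le_trans (modulusD _ _))// lerD//; last first.
    by rewrite modulusB ltW.
  rewrite (le_trans (dual_le (f - g) x))// ler_wpM2r ?rnorm_ge0//.
  exact: ltW.
have [f1 Ff1] := cF 1 ltr01.
have [L LE] : exists L : dual_space E, forall x, L x = l x.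
  apply: (@dual_mk l (rnorm f1 + 1)) => // x.
  have -> : l x = f1 x - (f1 x - l x) by rewrite opprB addrC subrK.
  rewrite mulrDl (le_trans (modulusD _ _))// lerD ?dual_le//.
  by rewrite modulusN; exact: near_l Ff1 x.
apply/cvg_ex; exists L; apply/cvg_rnormP => r r0.
have [|f Ff] := cF (r / 3); first by rewrite divr_gt0.
apply: filterS (Ff) => g /= fg.
have fL : rnorm (f - L) <= r / 3.
  apply: dual_rnorm_le => [|x]; first by rewrite ltW// divr_gt0.
  have -> : (f - L) x = f x - L x by [].
  by rewrite LE; apply: near_l => //; rewrite ltW// divr_gt0.
have -> : L - g = (L - f) + (f - g) by rewrite addrA subrK.
rewrite (le_lt_trans (rnormD _ _))// (rnormB L); lra.
Qed.

HB.instance Definition _ := Uniform_isComplete.Build (dual_space E) dual_complete.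
End dual_theory.

(** * Bounded sequences as functionals *)

Section c00.
Variables (R : realType) (k : scalar_kind).
Local Notation K := (scalars R k).

Definition c00 := fsupp K^o.

HB.instance Definition _ := GRing.Lmodule.on c00.

Implicit Type h : c00.

Definition c00_norm h : K := ofR (\sum_(i < fsupp_bound h) modulus (h i)).

Let c00_normE h N : (fsupp_bound h <= N)%N ->
  c00_norm h = ofR (\sum_(i < N) modulus (h i)).
Proof.
move=> hN; congr ofR.
apply: (@fsupp_sum_bound _ _ R (fun _ (x : K^o) => modulus x)) hN => _.
exact: modulus0.
Qed.

Let c00_normD h h' : c00_norm (h + h') <= c00_norm h + c00_norm h'.
Proof.
pose N := maxn (fsupp_bound (h + h')) (maxn (fsupp_bound h) (fsupp_bound h')).
rewrite !(@c00_normE _ N) ?leq_max ?leqnn ?orbT//.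
rewrite -ofRD ler_ofR -big_split/=; apply: ler_sum => i _; exact: modulusD.
Qed.

Let c00_normZ a h : c00_norm (a *: h) = `|a| * c00_norm h.
Proof.
pose N := maxn (fsupp_bound (a *: h)) (fsupp_bound h).
rewrite !(@c00_normE _ N) ?leq_max ?leqnn ?orbT//.
rewrite -ofR_modulus -ofRM mulr_sumr; congr ofR; apply: eq_bigr => i _.
exact: (modulusM a (h i)).
Qed.

Let c00_norm0_eq0 h : c00_norm h = 0 -> h = 0.
Proof.
move=> h0; apply: fsupp_inj => i; apply: modulus_eq0.
move: h0; rewrite (@c00_normE _ (maxn (fsupp_bound h) i.+1)) ?leq_maxl//.
rewrite -(@ofR0 R k) => /ofR_inj /eqP.
rewrite psumr_eq0 => [/allP h0|j _]; last exact: modulus_ge0.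
by have /eqP := h0 (Ordinal (leq_maxr (fsupp_bound h) i.+1)) (mem_index_enum _).
Qed.

HB.instance Definition _ :=
  Lmodule_isNormed.Build K c00 c00_normD c00_normZ c00_norm0_eq0.

Lemma c00_rnormE h N : (fsupp_bound h <= N)%N ->
  rnorm h = \sum_(i < N) modulus (h i).
Proof. by move=> hN; apply: (@ofR_inj R k); rewrite ofR_rnorm -c00_normE. Qed.

Lemma c00_rnorm_single n (c : K^o) : rnorm (single n c : c00) = modulus c.
Proof.
rewrite (@c00_rnormE _ (maxn (fsupp_bound (single n c)) n.+1)) ?leq_maxl//.
rewrite (bigD1 (Ordinal (leq_maxr _ _)))//= eqxx big1 ?addr0// => i.
by rewrite -val_eqE /= => /negbTE ->; rewrite modulus0.
Qed.

End c00.

Section sequences_as_functionals.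
Variables (R : realType) (k : scalar_kind).
Local Notation K := (scalars R k).
Local Notation c00 := (c00 R k).
Implicit Types (a b : nat -> K^o) (h : c00) (M : R).

Definition modulus_bounded a M := forall i, modulus (a i) <= M.

(** The identification of [ell_infty] with the dual of [c00]; the value [0] is taken
at unbounded sequences. *)
Definition seq_dual a : dual_space c00 :=
  xget 0 [set f : dual_space c00 |
    forall h, f h = \sum_(i < fsupp_bound h) h i * a i].

Lemma pairing_bound a h N : (fsupp_bound h <= N)%N ->
  \sum_(i < fsupp_bound h) h i * a i = \sum_(i < N) h i * a i.
Proof.
apply: (@fsupp_sum_bound _ _ K^o (fun i (c : K^o) => c * a i)) => i.
exact: mul0r.
Qed.

Lemma pairing_le a M N h : modulus_bounded a M ->
  modulus (\sum_(i < N) h i * a i) <= M * \sum_(i < N) modulus (h i).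
Proof.
move=> aM; rewrite (le_trans (modulus_sum _ _))// mulr_sumr ler_sum// => i _.
by rewrite modulusM mulrC ler_wpM2r ?modulus_ge0.
Qed.

Lemma seq_dualE a M h N : modulus_bounded a M -> (fsupp_bound h <= N)%N ->
  seq_dual a h = \sum_(i < N) h i * a i.
Proof.
move=> aM hN; rewrite -pairing_bound//.
have : exists f : dual_space c00, forall h,
    f h = \sum_(i < fsupp_bound h) h i * a i.
  apply: (@dual_mk _ _ _ (fun h : c00 => \sum_(i < fsupp_bound h) h i * a i) M).
    move=> c x y.
    pose N' := maxn (fsupp_bound (c *: x + y)) (maxn (fsupp_bound x) (fsupp_bound y)).
    rewrite !(@pairing_bound _ _ N') ?leq_max ?leqnn ?orbT//.
    rewrite scaler_sumr -big_split/=; apply: eq_bigr => i _.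
    by rewrite mulrDl -mulrA.
  by move=> x; rewrite (c00_rnormE (leqnn _)); exact: pairing_le.
by move=> /(xgetPex (0 : dual_space c00)); exact.
Qed.

Lemma seq_dual_single a M n (c : K^o) : modulus_bounded a M ->
  seq_dual a (single n c) = c * a n.
Proof.
move=> aM.
rewrite (@seq_dualE _ M _ (maxn (fsupp_bound (single n c)) n.+1)) ?leq_maxl//.
rewrite (bigD1 (Ordinal (leq_maxr _ _)))//= eqxx big1 ?addr0// => i.
by rewrite -val_eqE /= => /negbTE ->; rewrite mul0r.
Qed.

Lemma modulus_bounded_ge0 a M : modulus_bounded a M -> 0 <= M.
Proof. by move=> aM; exact: le_trans (modulus_ge0 _) (aM 0%N). Qed.

Lemma seq_dual_rnorm a M : modulus_bounded a M -> rnorm (seq_dual a) <= M.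
Proof.
move=> aM; apply: dual_rnorm_le => [|h]; first exact: modulus_bounded_ge0 aM.
by rewrite (seq_dualE aM (leqnn _)) (c00_rnormE (leqnn _)); exact: pairing_le.
Qed.

Lemma seq_dualD a b c M N M' : modulus_bounded a M -> modulus_bounded b N ->
  modulus_bounded c M' -> (forall i, a i = b i + c i) ->
  seq_dual a = seq_dual b + seq_dual c.
Proof.
move=> aM bN cM abc; apply: dual_ext => h.
have -> : (seq_dual b + seq_dual c) h = seq_dual b h + seq_dual c h by [].
rewrite (seq_dualE aM (leqnn _)) (seq_dualE bN (leqnn _)).
rewrite (seq_dualE cM (leqnn _)) -big_split /=; apply: eq_bigr => i _.
by rewrite abc mulrDr.
Qed.

Definition seq_unit n : nat -> K^o := fun i => (i == n)%:R.

Lemma seq_unit_bounded n : modulus_bounded (seq_unit n) 1.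
Proof.
by move=> i; rewrite /seq_unit; case: eqP => _; rewrite ?modulus1 ?modulus0.
Qed.

Definition truncate a n : nat -> K^o := fun i => if (i < n)%N then a i else 0.

Lemma seq_dual_truncate a n :
  seq_dual (truncate a n) = \sum_(i < n) a i *: seq_dual (seq_unit i).
Proof.
apply: dual_ext => h.
have tM : modulus_bounded (truncate a n) (\sum_(i < n) modulus (a i)).
  move=> i; rewrite /truncate; case: ltnP => iN.
    rewrite (bigD1 (Ordinal iN))//= lerDl sumr_ge0// => j _; exact: modulus_ge0.
  by rewrite modulus0 sumr_ge0// => j _; exact: modulus_ge0.
rewrite (seq_dualE tM (leq_maxl _ n)).
rewrite (big_morph (fun f : dual_space c00 => f h) (fun _ _ => erefl) erefl).
have hunit i : seq_dual (seq_unit i) h = h i.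
  rewrite (seq_dualE (@seq_unit_bounded i) (leq_maxl _ i.+1)).
  rewrite (bigD1 (Ordinal (leq_maxr _ _)))//= /seq_unit eqxx mulr1 big1 ?addr0//.
  by move=> j; rewrite -val_eqE /= => /negbTE ->; rewrite mulr0.
under [RHS]eq_bigr => i _.
  have -> : (a i *: seq_dual (seq_unit i)) h = h i * a i.
    by rewrite mulrC -[h i]hunit.
  over.
rewrite (big_ord_widen _ (fun i => h i * a i) (leq_maxr (fsupp_bound h) n)).
rewrite [RHS]big_mkcond; apply: eq_bigr => i _ /=.
by rewrite /truncate; case: ifP => // _; rewrite mulr0.
Qed.
End sequences_as_functionals.
(** * Weak compactness of the balls of ell2 in ell_infty *)

Lemma bounded_sums_tail (R : realType) (t : nat -> R) (B e : R) :
  (forall i, 0 <= t i) -> (forall n, \sum_(i < n) t i <= B) -> 0 < e ->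
  exists n, forall m, (n <= m)%N -> \sum_(n <= i < m) t i <= e.
Proof.
move=> t0 tB e0.
pose S := [set \sum_(i < n) t i | n in [set: nat]].
have Ssup : has_sup S.
  by split; [exists (\sum_(i < 0) t i), 0%N|exists B => _ [n _ <-]].
have [_ [n _ <-] nS] := sup_adherent e0 Ssup.
exists n => m nm.
have : \sum_(i < m) t i <= sup S by apply: ub_le_sup; [case: Ssup|exists m].
by rewrite -!(big_mkord xpredT t) in nS *; rewrite (big_cat_nat (leq0n n) nm)/=; lra.
Qed.

Section hilbert_ball.
Variables (R : realType) (k : scalar_kind).
Local Notation K := (scalars R k).
Local Notation c00 := (c00 R k).
Local Notation seqs := {ptws nat -> K^o}.
Variable C : R.

(** The sequences of [ell2] norm at most [`|C|], described by duality with finitely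
supported sequences: each condition involves finitely many coordinates, so that
the set is closed for pointwise convergence. *)
Definition hilbert_ball : set (nat -> K^o) :=
  [set a : nat -> K^o | forall N (h : nat -> K),
    modulus (\sum_(i < N) h i * a i) ^+ 2 <=
    C ^+ 2 * \sum_(i < N) modulus (h i) ^+ 2].

(** Take the conjugate of [a] for the test sequence, written as
[`|a i| ^+ 2 / a i]. *)
Lemma hilbert_ball_sum a N : hilbert_ball a ->
  \sum_(i < N) modulus (a i) ^+ 2 <= C ^+ 2.
Proof.
move=> aC; pose h i := ofR (modulus (a i) ^+ 2) / a i.
have hE i : h i * a i = ofR (modulus (a i) ^+ 2).
  rewrite /h; have [->|a0] := eqVneq (a i) 0; last by rewrite divfK.
  by rewrite modulus0 expr0n mulr0 ofR0.
have hM i : modulus (h i) = modulus (a i).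
  rewrite /h modulusM modulusV modulus_ofR ger0_norm ?sqr_ge0//.
  have [->|a0] := eqVneq (modulus (a i)) 0; first by rewrite expr0n mul0r.
  by rewrite expr2 mulfK.
have := aC N h.
under eq_bigr do rewrite hE.
under [X in _ * X]eq_bigr do rewrite hM.
rewrite -(big_morph ofR (@ofRD R k) (ofR0)) modulus_ofR real_normK ?num_real//.
set s := \sum_(i < N) _.
have s0 : 0 <= s by apply: sumr_ge0 => i _; exact: sqr_ge0.
have [->|sn0] := eqVneq s 0; first by move=> _; exact: sqr_ge0.
by rewrite expr2 ler_pM2r// lt_neqAle eq_sym sn0.
Qed.

Lemma hilbert_ball_bounded a : hilbert_ball a -> modulus_bounded a `|C|.
Proof.
move=> aC i; have := hilbert_ball_sum i.+1 aC.
rewrite big_ord_recr /= => h; rewrite -ler_sqr ?nnegrE ?modulus_ge0//.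
rewrite real_normK ?num_real//; apply: le_trans h.
by rewrite lerDr sumr_ge0// => j _; exact: sqr_ge0.
Qed.

Lemma hilbert_ball_tail a (e : R) : hilbert_ball a -> 0 < e ->
  exists n, forall i, (n <= i)%N -> modulus (a i) <= e.
Proof.
move=> aC e0.
have [|n nP] := @bounded_sums_tail R (fun i => modulus (a i) ^+ 2) (C ^+ 2)
    (e ^+ 2) (fun i => sqr_ge0 _) (fun n => hilbert_ball_sum n aC).
  by rewrite exprn_gt0.
exists n => i ni; have := nP i.+1 (leqW ni).
rewrite big_nat_recr//= => h; rewrite -ler_sqr ?nnegrE ?modulus_ge0 ?(ltW e0)//.
by apply: le_trans h; rewrite lerDr sumr_ge0// => j _; exact: sqr_ge0.
Qed.

Lemma nbhs_first_coords (a : seqs) n (r : R) : 0 < r ->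
  nbhs a [set b : seqs | forall i : 'I_n, modulus (a i - b i) < r].
Proof.
move=> r0.
have coord (i : nat) : nbhs a [set b : seqs | modulus (a i - b i) < r].
  have -> : [set b : seqs | modulus (a i - b i) < r] =
      @proj nat (fun _ => K^o) i @^-1` [set y : K^o | rnorm (a i - y) < r].
    by apply/funext => b /=; rewrite rnorm_scalar.
  exact: (@proj_continuous nat (fun _ => K^o) i a _ (nbhs_rnorm (a i : K^o) r0)).
have FF : Filter (nbhs a) by exact: nbhs_filter.
exact: (@filter_forall seqs 'I_n (fun i b => modulus (a i - b i) < r) (nbhs a)
  FF (fun i => coord i)).
Qed.

Lemma hilbert_ball_compact : compact (hilbert_ball : set seqs).
Proof.
have [A cA AC] := @compact_disk R k `|C|.
have cbox := @tychonoff nat (fun _ => K^o) (fun _ => A) (fun _ => cA).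
apply: (subclosed_compact _ cbox).
  move=> a aclos N h.
  pose B := \sum_(i < N) modulus (h i) ^+ 2.
  have B0 : 0 <= B by apply: sumr_ge0 => i _; exact: sqr_ge0.
  have mB (b : seqs) : hilbert_ball b ->
      modulus (\sum_(i < N) h i * b i) <= `|C| * Num.sqrt B.
    move=> /(_ N h) bB; rewrite -ler_sqr ?nnegrE ?modulus_ge0 ?mulr_ge0 ?sqrtr_ge0//.
    by rewrite exprMn sqr_sqrtr// real_normK ?num_real.
  have aB : modulus (\sum_(i < N) h i * a i) <= `|C| * Num.sqrt B.
    apply/ler_addgt0Pr => e e0.
    pose H := \sum_(i < N) modulus (h i).
    have H0 : 0 <= H by apply: sumr_ge0 => i _; exact: modulus_ge0.
    have r0 : 0 < e / (H + 1) by rewrite divr_gt0// ltr_wpDl.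
    have [b [bC ab]] := aclos _ (nbhs_first_coords (a : seqs) N r0).
    have -> : \sum_(i < N) h i * a i =
        \sum_(i < N) h i * b i + \sum_(i < N) h i * (a i - b i).
      by rewrite -big_split/=; apply: eq_bigr => i _; rewrite -mulrDr addrC subrK.
    rewrite (le_trans (modulusD _ _))// lerD ?mB//.
    rewrite (le_trans (modulus_sum _ _))//.
    apply: (@le_trans _ _ (H * (e / (H + 1)))).
      rewrite mulr_suml ler_sum// => i _; rewrite modulusM.
      by rewrite ler_wpM2l ?modulus_ge0// ltW// ab.
    by rewrite mulrA ler_pdivrMr ?ltr_wpDl// mulrC ler_pM2l// lerDl.
  rewrite -ler_sqr ?nnegrE ?modulus_ge0 ?mulr_ge0 ?sqrtr_ge0// in aB.
  by move: aB; rewrite exprMn sqr_sqrtr// real_normK ?num_real.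
by move=> a aC i; apply: AC; exact: hilbert_ball_bounded.
Qed.

Local Notation G := (dual_space c00).

(** The values of [f] at the unit vectors are summable: multiplied by suitable
scalars of modulus at most 1, finitely many unit vectors add up to a sequence of
norm at most 1. *)
Lemma functional_sum_le (f : dual_space G) n :
  \sum_(i < n) modulus (f (seq_dual (@seq_unit R k i))) <= rnorm f.
Proof.
pose t i := f (seq_dual (@seq_unit R k i)).
pose th : nat -> K^o := fun i => ofR (modulus (t i)) / t i.
have thE i : th i * t i = ofR (modulus (t i)).
  rewrite /th; have [->|t0] := eqVneq (t i) 0; last by rewrite divfK.
  by rewrite modulus0 mulr0 ofR0.
have thM : modulus_bounded (truncate th n) 1.
  move=> i; rewrite /truncate; case: ifP => _; last by rewrite modulus0.
  rewrite /th modulusM modulusV modulus_ofR ger0_norm ?modulus_ge0//.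
  have [->|a0] := eqVneq (modulus (t i)) 0; first by rewrite mul0r.
  by rewrite divff.
have := dual_le f (seq_dual (truncate th n)).
rewrite seq_dual_truncate (linear_fun_sum (dual_linear f)).
have -> : \sum_(i < n) f (th i *: seq_dual (@seq_unit R k i)) =
    ofR (\sum_(i < n) modulus (t i)) :> K.
  rewrite (big_morph ofR (@ofRD R k) ofR0); apply: eq_bigr => i _.
  by rewrite (linear_funZ (dual_linear f)) -thE.
rewrite -seq_dual_truncate modulus_ofR ger0_norm; last first.
  by apply: sumr_ge0 => i _; exact: modulus_ge0.
move=> /le_trans; apply; rewrite ler_piMr ?rnorm_ge0//.
exact: seq_dual_rnorm.
Qed.

(** On a ball of [ell2] a functional of [ell_infty] is the uniform limit of
finite combinations of coordinates.  Each [a] in the ball tends to [0], hence is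
the sup-norm limit of its truncations; the rate depends on [a], but the bound on
the remaining terms [a i * f (unit i)] depends only on the tail of the summable
sequence [f (unit i)]. *)
Lemma functional_tail (f : dual_space G) (e : R) : 0 < e -> exists n,
  forall a, hilbert_ball a ->
  modulus (f (seq_dual a) -
    \sum_(i < n) a i * f (seq_dual (@seq_unit R k i))) <= e.
Proof.
move=> e0; pose t i := modulus (f (seq_dual (@seq_unit R k i))).
have C1 : 0 < `|C| + 1 by rewrite ltr_wpDl.
have [|||n nP] := @bounded_sums_tail R t (rnorm f) (e / 2 / (`|C| + 1)).
- by move=> i; exact: modulus_ge0.
- exact: functional_sum_le.
- by rewrite !divr_gt0.
exists n => a aC.
have f1 : 0 < rnorm f + 1 by rewrite ltr_wpDl ?rnorm_ge0.
have e20 : 0 < e / 2 / (rnorm f + 1) by rewrite !divr_gt0.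
have [m0 m0P] := hilbert_ball_tail aC e20.
pose m := maxn n m0.
pose r : nat -> K^o := fun i => if (i < m)%N then 0 else a i.
have rM : modulus_bounded r (e / 2 / (rnorm f + 1)).
  move=> i; rewrite /r; case: ltnP => [_|mi]; first by rewrite modulus0 ltW.
  by apply: m0P; rewrite (leq_trans _ mi)// leq_maxr.
have aM := hilbert_ball_bounded aC.
have tM : modulus_bounded (truncate a m) `|C|.
  by move=> i; rewrite /truncate; case: ifP => // _; rewrite modulus0.
rewrite (@seq_dualD _ _ a (truncate a m) r _ _ _ aM tM rM); last first.
  by move=> i; rewrite /truncate /r; case: ifP; rewrite ?addr0 ?add0r.
rewrite (linear_funD (dual_linear f)) seq_dual_truncate.
rewrite (linear_fun_sum (dual_linear f)) addrAC.
have -> : \sum_(i < m) f (a i *: seq_dual (@seq_unit R k i)) =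
    \sum_(0 <= i < m) a i * f (seq_dual (@seq_unit R k i)).
  by rewrite big_mkord; apply: eq_bigr => i _; rewrite (linear_funZ (dual_linear f)).
rewrite -(big_mkord xpredT (fun i => a i * f (seq_dual (@seq_unit R k i)))).
rewrite (big_cat_nat (leq0n n) (leq_maxl n m0))/=.
rewrite [X in modulus (X + _)]addrAC subrr add0r.
rewrite (le_trans (modulusD _ _))// (splitr e) lerD//.
  rewrite (le_trans (modulus_sum _ _))//.
  apply: (@le_trans _ _ (`|C| * \sum_(n <= i < m) t i)).
    rewrite mulr_sumr ler_sum// => i _; rewrite modulusM.
    by rewrite ler_wpM2r ?modulus_ge0// aM.
  have := nP m (leq_maxl _ _); rewrite ler_pdivlMr// mulrC => h.
  apply: le_trans h; rewrite ler_wpM2r ?lerDl//.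
  by apply: sumr_ge0 => i _; exact: modulus_ge0.
rewrite (le_trans (dual_le _ _))//.
apply: (@le_trans _ _ (rnorm f * (e / 2 / (rnorm f + 1)))).
  by rewrite ler_wpM2l ?rnorm_ge0//; exact: seq_dual_rnorm.
by rewrite mulrA ler_pdivrMr// mulrC ler_pM2l ?divr_gt0// lerDl.
Qed.

Lemma seq_dual_weakly_continuous :
  {within (hilbert_ball : set seqs),
    continuous (@seq_dual R k : seqs -> weak_space G)}.
Proof.
apply: continuous_comp_initial; apply/subspace_continuousP => a aC.
apply/pointwise_cvgP => f; apply/cvg_rnormP => e e0.
have [|n nP] := @functional_tail f (e / 4); first by rewrite divr_gt0.
pose T := \sum_(i < n) modulus (f (seq_dual (@seq_unit R k i))).
have T0 : 0 <= T by apply: sumr_ge0 => i _; exact: modulus_ge0.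
have r0 : 0 < e / 4 / (T + 1) by rewrite !divr_gt0// ltr_wpDl.
have := nbhs_first_coords (a : seqs) n r0.
rewrite /= nbhs_simpl /within /=; apply: filterS => b ab bC /=.
rewrite rnorm_scalar /weak_eval.
have := nP a aC; have := nP b bC.
have : modulus (\sum_(i < n) a i * f (seq_dual (@seq_unit R k i)) -
    \sum_(i < n) b i * f (seq_dual (@seq_unit R k i))) <= e / 4.
  rewrite -sumrB (le_trans (modulus_sum _ _))//.
  apply: (@le_trans _ _ (e / 4 / (T + 1) * T)).
    rewrite mulr_sumr ler_sum// => i _; rewrite -mulrBl modulusM.
    by rewrite ler_wpM2r ?modulus_ge0// ltW.
  rewrite mulrAC ler_pdivrMr ?ltr_wpDl// ler_wpM2l ?lerDl//.
  by rewrite ltW// divr_gt0.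
set v := f _; set u := f _; set x := \sum_(i < n) _; set y := \sum_(i < n) _.
have -> : u - v = (u - x) + ((x - y) - (v - y)).
  by rewrite opprB addrA subrKA addrA subrK.
have := modulusD (u - x) ((x - y) - (v - y)).
have := modulusD (x - y) (- (v - y)); rewrite modulusN.
lra.
Qed.

(** The weak topology is separated because evaluations at the points of [c00]
are weakly continuous, so that the compact image is closed. *)
Lemma seq_dual_hilbert_ball_precompact :
  precompact (@seq_dual R k @` hilbert_ball : set (weak_space G)).
Proof.
have cI : compact (@seq_dual R k @` hilbert_ball : set (weak_space G)).
  exact: (@continuous_compact seqs (weak_space G) _ _
    seq_dual_weakly_continuous hilbert_ball_compact).
exists (@seq_dual R k @` hilbert_ball); first by [].
split => //; apply: compact_closed cI.
have inj : injective (@weak_eval R k G).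
  move=> f g fg; apply: dual_ext => h.
  have [ev evE] : exists ev : dual_space G, forall u, ev u = u h.
    apply: (@dual_mk _ _ _ (fun u : G => u h) (rnorm h)) => // u.
    by rewrite mulrC dual_le.
  have := congr1 (fun u => u ev) fg; by rewrite /weak_eval !evE.
move=> f g fg; apply: inj.
have : hausdorff_space {ptws dual_space G -> K^o}.
  by apply: hausdorff_product => x; exact: norm_hausdorff.
apply => A B Af Bg.
have [h [Ah Bh]] := fg _ _ (@initial_continuous _ _ (@weak_eval R k G) f A Af)
  (@initial_continuous _ _ (@weak_eval R k G) g B Bg).
by exists (weak_eval h).
Qed.
End hilbert_ball.
(** * Functionals on the projective tensor product *)

Lemma le_scaled_eps (R : realFieldType) (a b c : R) : 0 <= c ->
  (forall e, 0 < e -> a <= b + e * c) -> a <= b.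
Proof.
move=> c0 h; apply/ler_addgt0Pr => e e0.
have c1 : 0 < c + 1 by rewrite ltr_wpDl.
have := h (e / (c + 1)); rewrite divr_gt0// => /(_ isT) /le_trans; apply.
by rewrite lerD2l mulrAC ler_pdivrMr// ler_pM2l// lerDl.
Qed.

Lemma norming_functional (R : realType) (k : scalar_kind)
    (E : normedModType (scalars R k)) (x : E) :
  exists g : E -> (scalars R k)^o, [/\ linear g,
    g x = ofR (rnorm x) & forall v, modulus (g v) <= rnorm v].
Proof.
have [|||||g [glin gx gle]] := @hahn_banach R k E (scalars R k)^o
  (fun a => a *: x) (fun a => a * ofR (rnorm x)) rnorm.
- by move=> a u v; rewrite scalerDl scalerA.
- by move=> a u v; rewrite mulrDl -mulrA.
- exact: rnormD.
- exact: rnormZ.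
- by move=> a; rewrite rnormZ modulusM modulus_ofR ger0_norm ?rnorm_ge0.
by exists g; split=> //; have := gx 1; rewrite scale1r mul1r.
Qed.

Section dense_bound.
Variables (R : realType) (k : scalar_kind) (P : normedModType (scalars R k)).

Lemma dense_functional_le (D : set P) (g : P -> (scalars R k)^o) (B M : R) :
  dense D -> linear g -> 0 <= B -> 0 <= M ->
  (forall w, modulus (g w) <= B * rnorm w) ->
  (forall w, D w -> modulus (g w) <= M * rnorm w) ->
  forall w, modulus (g w) <= M * rnorm w.
Proof.
move=> Ddense glin B0 M0 gB gM w.
apply: (@le_scaled_eps _ _ _ (B + M)); first exact: addr_ge0.
move=> e e0; pose O := [set y | rnorm (w - y) < e]^°.
have [||v [/interior_subset /= wv Dv]] := Ddense O.
- by exists w; exact: nbhs_rnorm.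
- exact: open_interior.
have -> : g w = g (w - v) + g v by rewrite (linear_funB glin) subrK.
rewrite (le_trans (modulusD _ _))//.
have := gB (w - v); have := gM v Dv.
have : B * rnorm (w - v) <= B * e by rewrite ler_wpM2l// ltW.
have : M * rnorm v <= M * (rnorm w + e).
  rewrite ler_wpM2l//; have -> : v = w - (w - v) by rewrite opprB addrC subrK.
  by rewrite (le_trans (rnormD _ _))// lerD// rnormN ltW.
lra.
Qed.
End dense_bound.

Section projective_functionals.
Variables (R : realType) (k : scalar_kind).
Local Notation K := (scalars R k).
Variables (E F P : completeNormedModType K) (V : lmodType K).
Variables (t : {bilinear E -> F -> V}) (i : {linear V -> P}).
Hypothesis tP : is_tensor_product t.
Hypothesis inorm : forall v, infimums (representation_costs t v) `|i v|.

Lemma rnorm_tensor_le x y : rnorm (i (t x y)) <= rnorm x * rnorm y.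
Proof.
rewrite -(@ler_ofR R k) ofRM !ofR_rnorm; apply: (inorm _).1.
by exists [:: (x, y)]; rewrite big_seq1.
Qed.

(** A bound on pure tensors bounds the cost of every representation, hence
passes to their infimum.  The factor [M + e] makes the division possible when
[M = 0]. *)
Lemma tensor_bound (L : V -> K^o) (M : R) : linear L -> 0 <= M ->
  (forall x y, modulus (L (t x y)) <= M * (rnorm x * rnorm y)) ->
  forall v, modulus (L v) <= M * rnorm (i v).
Proof.
move=> Llin M0 LM v; apply: (@le_scaled_eps _ _ _ (rnorm (i v))).
  exact: rnorm_ge0.
move=> e e0; rewrite -mulrDl; have Me : 0 < M + e by rewrite ltr_wpDl.
rewrite mulrC -ler_pdivrMr// -(@ler_ofR R k) ofR_rnorm; apply: (inorm v).2.
move=> _ [s -> ->].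
have -> : \sum_(p <- s) `|p.1| * `|p.2| =
    ofR (\sum_(p <- s) rnorm p.1 * rnorm p.2).
  rewrite (big_morph ofR (@ofRD R k) ofR0); apply: eq_bigr => p _.
  by rewrite ofRM !ofR_rnorm.
rewrite ler_ofR ler_pdivrMr// mulrC mulr_sumr (linear_fun_sum Llin).
rewrite (le_trans (modulus_sum _ _))// ler_sum// => p _.
rewrite (le_trans (LM _ _))// ler_wpM2r ?mulr_ge0 ?rnorm_ge0// lerDl.
exact: ltW.
Qed.

(** The functional that the universal property gives on the algebraic tensor
product is extended to its completion by the Hahn-Banach theorem. *)
Lemma projective_functional (B : E -> F -> K^o) (M : R) :
  (forall y, linear (B ^~ y)) -> (forall x, linear (B x)) -> 0 <= M ->
  (forall x y, modulus (B x y) <= M * (rnorm x * rnorm y)) ->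
  exists c : P -> K^o, [/\ linear c, forall x y, c (i (t x y)) = B x y &
    forall w, modulus (c w) <= M * rnorm w].
Proof.
move=> Bl Br M0 BM.
pose Bb : {bilinear E -> F -> K^o} := HB.pack B
  (bilinear_isBilinear.Build K E F K^o *:%R *:%R B (Bl, Br)).
have [L LB _] := tP Bb.
have Llin : linear L by move=> a x y; rewrite linearP.
have Lle : forall v, modulus (L v) <= M * rnorm (i v).
  by apply: tensor_bound => // x y; rewrite LB; exact: BM.
have [|||||c [clin ci cle]] := @hahn_banach R k P V i L (fun w => M * rnorm w).
- by move=> a x y; rewrite linearP.
- exact: Llin.
- by move=> x y; rewrite -mulrDr ler_wpM2l// rnormD.
- by move=> a x; rewrite rnormZ mulrCA.
- exact: Lle.
by exists c; split=> // x y; rewrite ci LB.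
Qed.
End projective_functionals.

Lemma weakly_cvg_cauchy (R : realType) (k : scalar_kind)
    (E : normedModType (scalars R k)) (x : nat -> E) l :
  weakly_cvg x l -> weakly_cauchy x.
Proof.
move=> xl f; apply/cauchy_seqP => r r0.
have [|N NP] := (cvg_seqP _ _).1 (xl f) (r / 2); first by rewrite divr_gt0.
exists N => n m Nn Nm; have := NP n Nn; have := NP m Nm => h1 h2.
have -> : f (x n) - f (x m) = (f l - f (x m)) - (f l - f (x n)).
  by rewrite opprB [RHS]addrC subrKA.
by rewrite (le_lt_trans (rnormD _ _))// rnormN; lra.
Qed.

(** For a functional [phi] let [S : E -> F^*] be [u |-> phi (u tensor _)].  By
complete continuity [S (x n)] is norm Cauchy; it tends to [0] at each point of
[F], because [x n] is weakly null, hence it tends to [0] in norm. *)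
Lemma tensor_weakly_null (R : realType) (k : scalar_kind)
    (E F P : completeNormedModType (scalars R k)) (V : lmodType (scalars R k))
    (t : {bilinear E -> F -> V}) (i : {linear V -> P})
    (inorm : forall v, infimums (representation_costs t v) `|i v|)
    (all_cc : operators E (dual_space F) = cc_operators E (dual_space F))
    (x : nat -> E) (y : nat -> F) (B : R) :
  weakly_cvg x 0 -> (forall n, rnorm (y n) <= B) ->
  weakly_cvg (fun n => i (t (x n) (y n))) 0.
Proof.
move=> x0 yB phi.
have B0 : 0 <= B by exact: le_trans (rnorm_ge0 _) (yB 0%N).
have phile u v : modulus (phi (i (t u v))) <= rnorm phi * (rnorm u * rnorm v).
  by rewrite (le_trans (dual_le _ _))// ler_wpM2l ?rnorm_ge0// rnorm_tensor_le.
have [S SE] : {S : E -> dual_space F & forall u v, S u v = phi (i (t u v))}.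
  apply: (@choice E (dual_space F) (fun u f => forall v, f v = phi (i (t u v)))).
  move=> u; apply: (@dual_mk _ _ _ (fun v => phi (i (t u v))) (rnorm phi * rnorm u)).
    by move=> a v w; rewrite linearPr linearP dual_linear.
  by move=> v; rewrite -mulrA.
have Slin : linear S.
  move=> a u v; apply: dual_ext => w.
  have -> : (a *: S u + S v) w = a *: S u w + S v w by [].
  by rewrite !SE linearPl linearP dual_linear.
have Sop : operators E (dual_space F) S.
  apply/operatorsP; split=> //; exists (rnorm phi); first exact: rnorm_ge0.
  move=> u; apply: dual_rnorm_le => [|v]; first by rewrite mulr_ge0 ?rnorm_ge0.
  by rewrite SE -mulrA.
have xcauchy := weakly_cvg_cauchy x0.
have [_ /(_ x xcauchy) /cauchy_seqP Sx] : cc_operators E (dual_space F) S.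
  by rewrite -all_cc.
have Sx_le (r : R) : 0 < r -> exists N, forall n, (N <= n)%N -> rnorm (S (x n)) <= r.
  move=> r0; have [N NP] := Sx r r0; exists N => n Nn.
  apply: dual_rnorm_le => [|v]; first exact: ltW.
  apply/ler_addgt0Pr => e e0.
  have [f fE] : exists f : dual_space E, forall u, f u = S u v.
    apply: (@dual_mk _ _ _ (fun u => S u v) (rnorm phi * rnorm v)).
      by move=> a u w; rewrite Slin.
    by move=> u; rewrite SE (le_trans (phile _ _))// mulrAC mulrA.
  have [N' N'P] := (cvg_seqP _ _).1 (x0 f) e e0.
  pose m := maxn N N'.
  have h1 : modulus (S (x m) v) <= e.
    have := N'P m (leq_maxr _ _).
    rewrite (linear_fun0 (dual_linear f)) sub0r rnormN rnorm_scalar fE.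
    exact: ltW.
  have -> : S (x n) v = (S (x n) - S (x m)) v + S (x m) v.
    have -> : (S (x n) - S (x m)) v = S (x n) v - S (x m) v by [].
    by rewrite subrK.
  rewrite (le_trans (modulusD _ _))// lerD// (le_trans (dual_le _ _))//.
  by rewrite ler_wpM2r ?rnorm_ge0// ltW// NP// leq_maxl.
apply/cvg_seqP => r r0.
have B1 : 0 < B + 1 by rewrite ltr_wpDl.
have [|N NP] := Sx_le (r / 2 / (B + 1)); first by rewrite !divr_gt0.
exists N => n Nn; rewrite (linear_fun0 (dual_linear phi)) sub0r rnormN rnorm_scalar.
rewrite -SE (le_lt_trans (dual_le _ _))//.
apply: (@le_lt_trans _ _ (r / 2 / (B + 1) * (B + 1))).
  by rewrite ler_pM ?rnorm_ge0 ?NP// (le_trans (yB n))// lerDl.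
by rewrite divfK ?gt_eqF//; lra.
Qed.

(** The coordinates of the operator of the proof: as the [g n] lie in the unit
ball, multiplying the test sequence [h] by [g n x] does not increase its [ell2]
norm more than by the factor [`|x|], so that the bound on the [f n] passes to
pure tensors, then to the projective norm, and by density to the completion. *)
Lemma tensor_hilbert_coordinates (R : realType) (k : scalar_kind)
    (E F P : completeNormedModType (scalars R k)) (V : lmodType (scalars R k))
    (t : {bilinear E -> F -> V}) (i : {linear V -> P})
    (tP : is_tensor_product t)
    (inorm : forall v, infimums (representation_costs t v) `|i v|)
    (idense : dense (range i))
    (g : nat -> E -> (scalars R k)^o) (f : nat -> F -> (scalars R k)^o) (C : R) :
  0 <= C -> (forall n, linear (g n)) -> (forall n, linear (f n)) ->
  (forall n x, modulus (g n x) <= rnorm x) ->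
  (forall N (h : nat -> scalars R k) v,
     modulus (\sum_(i < N) h i * f i v) ^+ 2 <=
     (C * rnorm v) ^+ 2 * \sum_(i < N) modulus (h i) ^+ 2) ->
  exists c : nat -> P -> (scalars R k)^o,
    [/\ forall n, linear (c n),
        forall n x y, c n (i (t x y)) = g n x * f n y &
        forall w, hilbert_ball (C * rnorm w) (c ^~ w)].
Proof.
move=> C0 glin flin gle fle.
have f1 n v : modulus (f n v) <= C * rnorm v.
  rewrite -ler_sqr ?nnegrE ?modulus_ge0 ?mulr_ge0 ?rnorm_ge0//.
  have := fle n.+1 (@seq_unit R k n) v.
  rewrite !big_ord_recr/= !big1 => [|j _|j _]; rewrite /seq_unit ?(ltn_eqF (ltn_ord _)).
  - by rewrite !add0r eqxx mul1r modulus1 expr1n mulr1.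
  - by rewrite modulus0 expr0n.
  - by rewrite mul0r.
have ex_c n : exists c : P -> (scalars R k)^o, [/\ linear c,
    forall x y, c (i (t x y)) = g n x * f n y &
    forall w, modulus (c w) <= C * rnorm w].
  apply: (projective_functional tP inorm (B := fun x y => g n x * f n y)) => //.
  - by move=> y a u v; rewrite glin mulrDl -mulrA.
  - by move=> x a u v; rewrite flin mulrDr mulrCA.
  - by move=> x y; rewrite modulusM mulrCA ler_pM ?modulus_ge0.
have [c cP] := choice ex_c.
exists c; split=> [n|n|w]; [by case: (cP n)..|].
move=> N h.
pose H := \sum_(i < N) modulus (h i) ^+ 2.
have H0 : 0 <= H by apply: sumr_ge0 => j _; exact: sqr_ge0.
pose S w : (scalars R k)^o := \sum_(i < N) h i * c i w.
have clin n : linear (c n) by case: (cP n).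
have Slin : linear S.
  move=> a u v; rewrite /S scaler_sumr -big_split/=; apply: eq_bigr => j _.
  by rewrite clin mulrDr mulrCA.
have M0 : 0 <= C * Num.sqrt H by rewrite mulr_ge0 ?sqrtr_ge0.
have Sle : modulus (S w) <= C * Num.sqrt H * rnorm w.
  apply: (dense_functional_le (B := \sum_(j < N) modulus (h j) * C) idense Slin).
  - by apply: sumr_ge0 => j _; rewrite mulr_ge0 ?modulus_ge0.
  - exact: M0.
  - move=> v; rewrite mulr_suml (le_trans (modulus_sum _ _))// ler_sum// => j _.
    by rewrite modulusM -mulrA ler_wpM2l ?modulus_ge0//; case: (cP j).
  move=> _ [v _ <-].
  apply: (tensor_bound inorm (L := fun v => S (i v))) => //.
    by move=> a u u'; rewrite linearP Slin.
  move=> x y.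
  have -> : S (i (t x y)) = \sum_(j < N) (h j * g j x) * f j y.
    by apply: eq_bigr => j _; case: (cP j) => _ -> _; rewrite mulrA.
  rewrite -ler_sqr ?nnegrE ?modulus_ge0 ?mulr_ge0 ?sqrtr_ge0 ?rnorm_ge0//.
  rewrite (le_trans (fle N (fun j => h j * g j x) y))//.
  have -> : (C * Num.sqrt H * (rnorm x * rnorm y)) ^+ 2 =
      (C * rnorm y) ^+ 2 * (H * rnorm x ^+ 2).
    by rewrite -{2}(sqr_sqrtr H0); ring.
  rewrite ler_wpM2l ?sqr_ge0// mulr_suml ler_sum// => j _.
  rewrite modulusM exprMn ler_wpM2l ?sqr_ge0//.
  by rewrite ler_sqr ?nnegrE ?modulus_ge0 ?rnorm_ge0.
rewrite -/H -(sqr_sqrtr H0) -exprMn -/(S w) ler_sqr ?nnegrE ?modulus_ge0//.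
  by rewrite mulrAC.
by rewrite mulrAC mulr_ge0 ?rnorm_ge0.
Qed.

(** * A weakly compact operator that is not completely continuous *)

Theorem theorem3 (R : realType) (k : scalar_kind)
    (E F EF : completeNormedModType (scalars R k))
    (EF_tensor : is_projective_tensor_product E F EF)
    (E_not_schur : ~ schur_property E)
    (F_ell1 : contains_copy_of_ell1 F)
    (all_cc : operators E (dual_space F) = cc_operators E (dual_space F)) :
  ~ dunford_pettis_property EF.
Proof.
have [V [t [i [tP inorm idense]]]] := EF_tensor.
have [y [f [B [C [C0 yB flin fy fle]]]]] := ell1_copy_hilbertian_functionals F_ell1.
move=> DP; apply: E_not_schur => u l ul.
pose x n := u n - l.
have x0 : weakly_cvg x 0.
  move=> phi; apply/cvg_seqP => r r0.
  have [N NP] := (cvg_seqP _ _).1 (ul phi) r r0; exists N => n Nn.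
  rewrite (linear_funB (dual_linear phi)) (linear_fun0 (dual_linear phi)).
  by rewrite sub0r opprB; exact: NP.
have [g gP] := choice (fun n => norming_functional (x n)).
have [|n v|c [clin ct cball]] := @tensor_hilbert_coordinates R k E F EF V t i
    tP inorm idense g f C C0 _ flin _ fle.
- by move=> n; case: (gP n).
- by case: (gP n) => _ _; exact.
have cM w : modulus_bounded (c ^~ w) (C * rnorm w).
  have := hilbert_ball_bounded (cball w).
  by rewrite ger0_norm ?mulr_ge0 ?rnorm_ge0.
pose T w : dual_space (c00 R k) := seq_dual (c ^~ w).
have Tlin : linear T.
  move=> a w w'; apply: dual_ext => h.
  have -> : (a *: T w + T w') h = a *: T w h + T w' h by [].
  rewrite !(seq_dualE (cM _) (leqnn _)) scaler_sumr -big_split/=.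
  apply: eq_bigr => j _; rewrite clin mulrDr; congr (_ + _).
  exact: mulrCA.
have Top : operators EF (dual_space (c00 R k)) T.
  apply/operatorsP; split=> //; exists C => // w; exact: seq_dual_rnorm.
have Twc : weakly_compact_operators EF (dual_space (c00 R k)) T.
  split=> //; apply: precompact_subset (seq_dual_hilbert_ball_precompact k C).
  move=> _ [w /= w1 <-]; exists (c ^~ w) => // N h.
  rewrite (le_trans (cball w N h))// ler_wpM2r//.
    by apply: sumr_ge0 => j _; exact: sqr_ge0.
  rewrite ler_sqr ?nnegrE ?mulr_ge0 ?rnorm_ge0// ler_piMr//.
  by rewrite rnorm_le ofR1.
pose w n := i (t (x n) (y n)).
have [_ /(_ w)] := DP _ _ Twc.
have wc : weakly_cauchy w.
  exact: weakly_cvg_cauchy (tensor_weakly_null inorm all_cc x0 yB).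
move=> /(_ wc) /cauchy_seqP Tw.
apply/cvg_ex; exists l; apply/cvg_seqP => r r0.
have [N NP] := Tw r r0; exists N => n Nn.
rewrite rnormB -/(x n); apply: le_lt_trans (NP n n.+1 Nn (leqW Nn)).
(* The functional [T (w m)] takes the value [`|x n|] at the [n]-th unit vector
   if [m = n], and the value [0] otherwise. *)
have := dual_le (T (w n) - T (w n.+1))
  (single n (1 : (scalars R k)^o) : c00 R k).
rewrite c00_rnorm_single modulus1 mulr1.
have -> : (T (w n) - T (w n.+1)) (single n (1 : (scalars R k)^o)) =
   T (w n) (single n (1 : (scalars R k)^o)) -
   T (w n.+1) (single n (1 : (scalars R k)^o)) by [].
rewrite !(seq_dual_single _ _ (cM _)) !mul1r !ct !fy eqxx (ltn_eqF (ltnSn n)).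
rewrite mulr1 mulr0 subr0; case: (gP n) => _ -> _.
by rewrite modulus_ofR ger0_norm ?rnorm_ge0.
Qed.
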